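(* The problem Balanced Cluster Editing (BCE), parameterized by $k$, admits a kernel with $\mathcal{O}(k^3)$ vertices: there is a polynomial-time algorithm that, given an instance $(G,k,\eta)$ of BCE, outputs an equivalent instance $(G',k',\eta')$ of BCE (a yes-instance if and only if $(G,k,\eta)$ is) with $|V(G')|=\mathcal{O}(k^3)$ and $k'\le k$.
   Context: All graphs are finite and simple. A cluster graph is a graph in which every connected component is a clique. For a non-negative integer $\eta$, a graph is $\eta$-balanced if for any two connected components $H,H'$ we have $\big||V(H)|-|V(H')|\big|\le\eta$. For $F\subseteq\binom{V(G)}{2}$, $G\triangle F$ is the graph with vertex set $V(G)$ and edge set the symmetric difference $E(G)\triangle F$. Balanced Cluster Editing (BCE): given a graph $G$ and non-negative integers $k,\eta$, decide whether there is $F\subseteq\binom{V(G)}{2}$ with $|F|\le k$ such that $G\triangle F$ is an $\eta$-balanced cluster graph. *)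

(* Defs.v *)
From mathcomp Require Import all_boot all_order all_algebra.

Set Implicit Arguments.
Unset Strict Implicit.
Unset Printing Implicit Defensive.

Definition pairs (V : finType) : {set {set V}} := [set e : {set V} | #|e| == 2].

Record graph (V : finType) := Graph {
  edges : {set {set V}};
  edges_pairs : edges \subset pairs V
}.

(* Irreflexive, since an edge has exactly two elements. *)
Definition adj (V : finType) (G : graph V) : rel V :=
  fun x y => [set x; y] \in edges G.

Definition component_of (V : finType) (G : graph V) (x : V) : {set V} :=
  [set y | connect (adj G) x y].

Definition components (V : finType) (G : graph V) : {set {set V}} :=
  [set component_of G x | x : V].

Definition clique (V : finType) (G : graph V) (A : {set V}) : Prop :=
  forall x y, x \in A -> y \in A -> x != y -> adj G x y.

Definition cluster_graph (V : finType) (G : graph V) : Prop :=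
  forall H, H \in components G -> clique G H.

Definition balanced (V : finType) (eta : nat) (G : graph V) : Prop :=
  forall H H', H \in components G -> H' \in components G ->
    (absz (Posz #|H| - Posz #|H'|)%R <= eta)%N.

Definition symdiff (T : finType) (A B : {set T}) : {set T} :=
  (A :\: B) :|: (B :\: A).

Lemma symdiff_subset (T : finType) (A B C : {set T}) :
  A \subset C -> B \subset C -> symdiff A B \subset C.
Proof.
move=> sAC sBC; rewrite subUset.
by rewrite (subset_trans (subsetDl _ _) sAC) (subset_trans (subsetDl _ _) sBC).
Qed.

Definition edit (V : finType) (G : graph V) (F : {set {set V}})
    (FP : F \subset pairs V) : graph V :=
  Graph (symdiff_subset (edges_pairs G) FP).

Record instance := Instance {
  nverts : nat;
  igraph : graph 'I_nverts;
  budget : nat;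
  imbalance : nat
}.

Definition yes_instance (I : instance) : Prop :=
  exists (F : {set {set 'I_(nverts I)}}) (FP : F \subset pairs 'I_(nverts I)),
    [/\ #|F| <= budget I,
        cluster_graph (edit (igraph I) FP) &
        balanced (imbalance I) (edit (igraph I) FP)].

Definition bitlen (m : nat) : nat := (trunc_log 2 m).+1.

(* Adjacency matrix, with n, k and eta written in binary. *)
Definition isize (I : instance) : nat :=
  nverts I * nverts I + bitlen (nverts I) + bitlen (budget I)
  + bitlen (imbalance I).

(* Polynomial time is measured on a random access machine with scalar         *)
(* registers, an unbounded memory addressed indirectly, unit cost, and only   *)
(* addition and truncated subtraction as arithmetic. There is deliberately no *)
(* multiplication: bit lengths then grow by at most one per step, so that     *)
(* unit-cost time is polynomially equivalent to Turing machine time.          *)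
Record state := State { regs : nat -> nat; memory : nat -> nat }.

Definition upd (f : nat -> nat) (a v : nat) : nat -> nat :=
  fun b => if b == a then v else f b.

Inductive cmd : Type :=
| Skip
| Const (r c : nat)
| Add (r a b : nat)
| Sub (r a b : nat)
| Read (r a : nat)
| Write (a r : nat)
| Seq (p q : cmd)
| If (r : nat) (p q : cmd)
| While (r : nat) (p : cmd).

Definition set_reg (s : state) (r v : nat) : state :=
  State (upd (regs s) r v) (memory s).

Definition set_mem (s : state) (a v : nat) : state :=
  State (regs s) (upd (memory s) a v).

(* [exec p s t s']: started in s, p halts in s' after exactly t steps. The    *)
(* operands of Add, Sub, Read and Write are register numbers; tests are for   *)
(* a nonzero register.                                                        *)
Inductive exec : cmd -> state -> nat -> state -> Prop :=
| exec_skip s : exec Skip s 1 s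
| exec_const s r c : exec (Const r c) s 1 (set_reg s r c)
| exec_add s r a b :
    exec (Add r a b) s 1 (set_reg s r (regs s a + regs s b))
| exec_sub s r a b :
    exec (Sub r a b) s 1 (set_reg s r (regs s a - regs s b))
| exec_read s r a : exec (Read r a) s 1 (set_reg s r (memory s (regs s a)))
| exec_write s a r : exec (Write a r) s 1 (set_mem s (regs s a) (regs s r))
| exec_seq p q s1 s2 s3 t u :
    exec p s1 t s2 -> exec q s2 u s3 -> exec (Seq p q) s1 (t + u) s3
| exec_if_true r p q s s' t :
    regs s r != 0 -> exec p s t s' -> exec (If r p q) s t.+1 s'
| exec_if_false r p q s s' t :
    regs s r = 0 -> exec q s t s' -> exec (If r p q) s t.+1 s'
| exec_while_stop r p s : regs s r = 0 -> exec (While r p) s 1 s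
| exec_while_loop r p s1 s2 s3 t u :
    regs s1 r != 0 -> exec p s1 t s2 -> exec (While r p) s2 u s3 ->
    exec (While r p) s1 (t + u).+1 s3.

(* Registers 0, 1, 2 hold n, k and eta; memory holds the row-major adjacency  *)
(* matrix from address 0. Everything else is initially 0.                     *)
Definition input_state (I : instance) : state :=
  State
    (fun r => match r with
              | 0 => nverts I | 1 => budget I | 2 => imbalance I | _ => 0 end)
    (fun a => nat_of_bool
       [exists i : 'I_(nverts I), exists j : 'I_(nverts I),
          (a == i * nverts I + j) && adj (igraph I) i j]).

Definition output_state (s : state) (I : instance) : Prop :=
  [/\ regs s 0 = nverts I, regs s 1 = budget I, regs s 2 = imbalance I &
      forall i j : 'I_(nverts I),
        memory s (i * nverts I + j) = nat_of_bool (adj (igraph I) i j)].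

(* The bound on [isize (f I)] charges for the length of the output: memory    *)
(* cells that are still 0 could otherwise be output without being written.    *)
Definition polytime_computable (f : instance -> instance) : Prop :=
  exists (p : cmd) (c d : nat), forall I : instance,
    exists (t : nat) (s : state),
      [/\ exec p (input_state I) t s,
          output_state s (f I),
          t <= c * isize I ^ d + c &
          isize (f I) <= c * isize I ^ d + c].

(* Main.v *)
Require Import Defs.
From mathcomp Require Import all_boot all_order all_algebra.
From mathcomp Require Import zify.

(** Vertices with equal closed neighbourhoods are twins. A solution with at most
    k edits touches at most 2k vertices, so a twin class with more than 2k members
    contains an untouched vertex, and the closed neighbourhood of the class is
    then a cluster of every solution. The vertices outside these forced clusters
    form clusters of size at most 4k. Hence trimming every twin class to 4k+1
    vertices keeps the forced clusters at least as large as all others; if other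
    vertices exist, only the largest forced cluster matters for balance, and eta
    is decreased by the amount by which it shrinks; otherwise all cluster sizes are
    known and balance is checked directly. Isolated cliques of equal size are
    interchangeable and at most 2k of them are touched, so 2k+1 copies per size
    suffice; there are O(k) sizes, which gives O(k^3) vertices. In a yes-instance
    there are at most 4k further twin classes, of O(k) vertices each.

    All quantities involved are expressions built from addition, truncated
    subtraction, case distinction, memory access and sums over the vertices. Such
    expressions are compiled to the machine with a polynomial running time, the
    degree being the nesting depth of the sums. *)

Set Implicit Arguments.
Unset Strict Implicit.
Unset Printing Implicit Defensive.

(** * Solutions as vertex labellings *)

Section Solutions.
Variables (V : finType) (a : rel V).
Implicit Types (S : {set V}) (l : V -> nat) (k eta : nat).

(** Equal labels mean same cluster, and [a] will be a closed-neighbourhood relation, so the diagonal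
    contributes nothing. The pairs are ordered, so every edit is counted twice; this is where [k.*2]
    in [solution] comes from. *)
Definition mismatches S l : {set V * V} :=
  [set p | [&& p.1 \in S, p.2 \in S & (l p.1 == l p.2) != a p.1 p.2]].

Definition cluster S l x : {set V} := [set z in S | l z == l x].

Definition solution S k eta l : Prop :=
  #|mismatches S l| <= k.*2 /\
  {in S &, forall x y, #|cluster S l x| <= #|cluster S l y| + eta}.

Definition editable S k eta : Prop := exists l, solution S k eta l.

Definition touched S l : {set V} := [set p.1 | p in mismatches S l].

Lemma untouched_label S l x y :
  x \in S -> y \in S -> x \notin touched S l -> (l x == l y) = a x y.
Proof.
move=> xS yS; apply: contraNeq => nxy.
by apply/imsetP; exists (x, y); rewrite // inE /= xS yS.
Qed.

Lemma card_touched S k eta l : solution S k eta l -> #|touched S l| <= k.*2.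
Proof. by case=> + _; apply: leq_trans; apply: leq_imset_card. Qed.

Lemma sub_mismatches S S' l :
  S \subset S' -> #|mismatches S l| <= #|mismatches S' l|.
Proof.
move=> sS; apply: subset_leq_card; apply/subsetP => p; rewrite !inE.
by case/and3P=> /(subsetP sS) -> /(subsetP sS) -> ->.
Qed.

End Solutions.

(** Mismatches and clusters correspond bijectively under [phi], so it suffices to carry labels in
    both directions. *)
Lemma editable_transport (V1 V2 : finType) (a1 : rel V1) (a2 : rel V2)
    (S1 : {set V1}) (S2 : {set V2}) (phi : V1 -> V2) k eta :
  {in S1 &, injective phi} -> phi @: S1 = S2 ->
  {in S1 &, forall x y, a2 (phi x) (phi y) = a1 x y} ->
  editable a1 S1 k eta <-> editable a2 S2 k eta.
Proof.
move=> injf <- morf.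
have core l1 l2 : {in S1, forall x, l2 (phi x) = l1 x} ->
    solution a1 S1 k eta l1 <-> solution a2 (phi @: S1) k eta l2.
  move=> ll.
  have mE : #|mismatches a2 (phi @: S1) l2| = #|mismatches a1 S1 l1|.
    rewrite -(@card_in_imset _ _ (fun p => (phi p.1, phi p.2))).
      apply: eq_card => -[y1 y2]; apply/idP/imsetP.
        rewrite inE /= => /and3P[/imsetP[x1 x1S ->] /imsetP[x2 x2S ->]].
        by rewrite !ll // morf // => h; exists (x1, x2); rewrite // inE /= x1S x2S.
      case=> -[x1 x2]; rewrite inE /= => /and3P[x1S x2S h] [-> ->].
      by rewrite inE /= !imset_f // !ll // morf.
    move=> [x1 x2] [y1 y2]; rewrite !inE /= => /and3P[x1S x2S _] /and3P[y1S y2S _].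
    by case=> /injf -> // /injf -> //.
  have cE x : x \in S1 -> #|cluster (phi @: S1) l2 (phi x)| = #|cluster S1 l1 x|.
    move=> xS; rewrite -(@card_in_imset _ _ phi).
      apply: eq_card => y; apply/idP/imsetP.
        by rewrite inE => /andP[/imsetP[z zS ->]]; rewrite !ll // => h; exists z; rewrite // inE zS.
      by case=> z; rewrite inE => /andP[zS h] ->; rewrite inE imset_f // !ll.
    by move=> y z; rewrite !inE => /andP[yS _] /andP[zS _]; apply: injf.
  rewrite /solution mE; split=> -[-> h]; split=> //.
    by move=> _ _ /imsetP[x xS ->] /imsetP[y yS ->]; rewrite !cE //; apply: h.
  by move=> x y xS yS; rewrite -!cE //; apply: h; apply: imset_f.
split=> -[l sl].
  (* By injectivity the sum has exactly one term when [y] lies in the image, so it reads off the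
     label of the preimage without choosing an inverse of [phi]. *)
  exists (fun y => \sum_(x in S1 | phi x == y) l x).
  apply: (proj1 (core l _ _)) sl => x xS /=.
  rewrite (big_pred1 x) // => y /=; apply/andP/eqP => [[yS /eqP]|->]; last by [].
  exact: injf.
by exists (l \o phi); apply: (proj2 (core _ l _)) sl.
Qed.

(** * Edit sets of graphs and labellings *)

Definition nbr (V : finType) (G : graph V) : rel V := fun x y => (x == y) || adj G x y.

Lemma adj_sym (V : finType) (G : graph V) x y : adj G x y = adj G y x.
Proof. by rewrite /adj setUC. Qed.

Lemma adj_irr (V : finType) (G : graph V) x : adj G x x = false.
Proof.
apply/negP => /(subsetP (edges_pairs G)).
by rewrite inE setUid cards1.
Qed.

Lemma nbr_refl (V : finType) (G : graph V) : reflexive (nbr G).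
Proof. by move=> x; rewrite /nbr eqxx. Qed.

Lemma nbr_sym (V : finType) (G : graph V) : symmetric (nbr G).
Proof. by move=> x y; rewrite /nbr eq_sym adj_sym. Qed.

Lemma adj_nbr (V : finType) (G : graph V) x y :
  adj G x y = (x != y) && nbr G x y.
Proof. by rewrite /nbr; case: eqP => // ->; rewrite adj_irr. Qed.

Lemma adj_edit (V : finType) (G : graph V) (F : {set {set V}}) (FP : F \subset pairs V) x y :
  adj (edit G FP) x y = (adj G x y != ([set x; y] \in F)).
Proof.
rewrite /adj /edit /= /symdiff !inE.
by case: (_ \in edges G); case: (_ \in F).
Qed.

Lemma set2_inj (V : finType) (x y x' y' : V) : [set x; y] = [set x'; y'] ->
  (x', y') \in [set (x, y); (y, x)].
Proof.
move=> e; rewrite !inE !xpair_eqE.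
have := set21 x' y'; have := set22 x' y'; rewrite -e !inE.
have := set21 x y; have := set22 x y; rewrite e !inE.
rewrite (eq_sym x x') (eq_sym x y') (eq_sym y x') (eq_sym y y').
by case: (x' == x); case: (y' == y); case: (x' == y); case: (y' == x).
Qed.

(** Grouping the ordered pairs by their underlying set puts exactly [(x, y)] and [(y, x)] into the
    block of each edge. *)
Lemma card_ordered_pairs (V : finType) (F : {set {set V}}) : F \subset pairs V ->
  #|[set p : V * V | (p.1 != p.2) && ([set p.1; p.2] \in F)]| = #|F|.*2.
Proof.
move=> FP; rewrite -sum1_card (partition_big (fun p => [set p.1; p.2]) (mem F)) /=; last first.
  by move=> p; rewrite inE => /andP[].
rewrite -muln2 -sum_nat_const; apply: eq_bigr => e eF.
have /cards2P[x [y [nxy ee]]] : #|e| == 2 by have := subsetP FP _ eF; rewrite inE.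
rewrite sum1_card; transitivity #|[set (x, y); (y, x)]|; last first.
  by rewrite cards2 xpair_eqE (negbTE nxy).
apply: eq_card => -[u v]; rewrite unfold_in /= !inE /=.
apply/andP/idP => [[_ /eqP]|].
  by rewrite ee => /esym /set2_inj; rewrite !inE.
rewrite !xpair_eqE => /orP[] /andP[/eqP -> /eqP ->].
  by rewrite nxy -ee eF.
by rewrite eq_sym nxy setUC -ee eF.
Qed.

Section ClusterGraphs.
Variables (V : finType) (G : graph V).

Lemma connect_adj_sym : connect_sym (adj G).
Proof. by apply: sym_connect_sym => x y; apply: adj_sym. Qed.

Lemma cluster_connect : cluster_graph G -> forall x y, connect (adj G) x y = nbr G x y.
Proof.
move=> cG x y; apply/idP/idP => [c|].
  rewrite /nbr; case: eqP => //= /eqP nxy.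
  apply: (cG (component_of G x)) => //; first exact: imset_f.
    by rewrite inE.
  by rewrite inE.
by case/orP=> [/eqP -> //|/connect1].
Qed.

(** Labels agree across every edge, hence along every path. *)
Lemma labelled_connect l : (forall x y, (l x == l y :> nat) = nbr G x y) ->
  forall x y, connect (adj G) x y = (l x == l y).
Proof.
move=> lG x y; apply/idP/idP; last by rewrite lG => /orP[/eqP -> //|/connect1].
case/connectP=> p; elim: p x => [|z p IH] x /=; first by move=> _ ->.
case/andP=> xz /IH h /h /eqP <-; by rewrite lG /nbr xz orbT.
Qed.

End ClusterGraphs.

(** An edit set yields the labelling by connected components of the edited graph; a labelling yields
    the edit set of all pairs on which it disagrees with the graph. *)
Lemma yes_instanceE I :
  yes_instance I <->
  editable (nbr (igraph I)) [set: 'I_(nverts I)] (budget I) (imbalance I).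
Proof.
case: I => n G k eta; rewrite /yes_instance /=; split.
  case=> F [FP [Fk cG bG]]; set G' := edit G FP in cG bG.
  (* The label is the index of the canonical root of the component. *)
  pose l x := nat_of_ord (enum_rank (fingraph.root (adj G') x)).
  have lE x y : (l x == l y) = nbr G' x y.
    rewrite -(cluster_connect cG) /l -(root_connect (@connect_adj_sym _ G')).
    by rewrite (inj_eq val_inj) (inj_eq enum_rank_inj).
  have comp x : component_of G' x = cluster setT l x.
    by apply/setP => z; rewrite !inE lE nbr_sym (cluster_connect cG).
  exists l; split.
    apply: leq_trans (_ : #|F|.*2 <= _); last by rewrite leq_double.
    rewrite -(card_ordered_pairs FP); apply: subset_leq_card; apply/subsetP => -[x y].
    rewrite !inE /= lE /nbr; case: (eqVneq x y) => /= _ //.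
    rewrite /G' adj_edit.
    by case: (adj G x y); case: (_ \in F).
  move=> x y _ _; rewrite -!comp.
  have := bG (component_of G' x) (component_of G' y) (imset_f _ _) (imset_f _ _).
  by move=> /(_ isT isT); lia.
case=> l [lk lb].
pose F := [set e in pairs 'I_n | [exists x, exists y, (e == [set x; y]) && ((l x == l y) != nbr G x y)]].
have FP : F \subset pairs 'I_n by apply/subsetP => e; rewrite inE => /andP[].
have FE x y : x != y -> ([set x; y] \in F) = ((l x == l y) != nbr G x y).
  move=> nxy; rewrite !inE cards2 nxy /=; apply/existsP/idP => [[u /existsP[v /andP[/eqP e h]]]|h].
    move/set2_inj: e; rewrite !inE !xpair_eqE => /orP[] /andP[/eqP <- /eqP <-] //.
    by rewrite (eq_sym (l _)) nbr_sym.
  by exists x; apply/existsP; exists y; rewrite eqxx.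
have lE x y : (l x == l y) = nbr (edit G FP) x y.
  rewrite /nbr; case: (eqVneq x y) => [-> |nxy] /=; first by rewrite eqxx.
  rewrite adj_edit FE // /nbr (negbTE nxy) /=.
  by case: (_ == _); case: (adj _ _ _).
have comp x : component_of (edit G FP) x = cluster setT l x.
  by apply/setP => z; rewrite !inE (labelled_connect lE) eq_sym.
exists F, FP; split.
- rewrite -leq_double; apply: leq_trans lk; rewrite -(card_ordered_pairs FP).
  apply: subset_leq_card; apply/subsetP => -[x y].
  by rewrite inE => /andP[/= nxy]; rewrite FE // => h; rewrite !inE.
- move=> H /imsetP[x _ ->] y z; rewrite comp !inE => /eqP hy /eqP hz nyz.
  by rewrite adj_nbr nyz -lE hy hz eqxx.
- move=> _ _ /imsetP[x _ ->] /imsetP[y _ ->]; rewrite !comp.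
  have := lb x y (in_setT x) (in_setT y); have := lb y x (in_setT y) (in_setT x).
  lia.
Qed.

(** * Trimming twin classes and removing isolated cliques *)

Section Rank.
Variables (n : nat) (P : {set 'I_n}).

Definition rank (i : nat) : nat := #|[set j in P | j < i]|.

Lemma ltn_rank (i : 'I_n) j : i \in P -> i < j -> rank i < rank j.
Proof.
move=> iP ij; apply: proper_card; apply/properP; split; last first.
  by exists i; rewrite !inE iP ?ltnn.
apply/subsetP => u; rewrite !inE => /andP[->] /= ui; exact: ltn_trans ui ij.
Qed.

Lemma rank_inj : {in P &, injective (fun i : 'I_n => rank i)}.
Proof.
move=> i j iP jP /= e; apply/val_inj => /=; case: (ltngtP i j) => // h.
  by have := ltn_rank iP h; rewrite e ltnn.
by have := ltn_rank jP h; rewrite e ltnn.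
Qed.

Lemma rank_lt_card (i : 'I_n) : i \in P -> rank i < #|P|.
Proof.
move=> iP; apply: proper_card; apply/properP; split; last by exists i; rewrite // inE iP ltnn.
by apply/subsetP => u; rewrite inE => /andP[].
Qed.

Lemma rank_surj r : r < #|P| -> exists2 i : 'I_n, i \in P & rank i = r.
Proof.
move=> rP; pose f (i : 'I_n) : 'I_#|P| := insubd (Ordinal rP) (rank i).
have fE i : i \in P -> f i = rank i :> nat.
  by move=> iP; rewrite /f val_insubd rank_lt_card.
have fi : {in P &, injective f}.
  move=> i j iP jP e; apply: rank_inj => //=.
  by rewrite -fE // -[RHS]fE // e.
have : f @: P = setT.
  by apply/eqP; rewrite eqEcard subsetT cardsT card_ord (card_in_imset fi) leqnn.
move/setP/(_ (Ordinal rP)); rewrite inE => /imsetP[i iP e].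
by exists i => //; rewrite -fE // -e.
Qed.

(** Injections in both directions: [rank] sends the set into ['I_m], and [rank_surj] provides a
    member for each value below the minimum. *)
Lemma card_rank_lt m : #|[set i in P | rank i < m]| = minn #|P| m.
Proof.
pose Q := [set i in P | rank i < m].
have le1 : #|Q| <= minn #|P| m.
  rewrite leq_min; apply/andP; split.
    by apply: subset_leq_card; apply/subsetP => i; rewrite inE => /andP[].
  case: (posnP m) => [m0|mpos].
    by rewrite m0 leqn0 cards_eq0 -subset0; apply/subsetP => i; rewrite !inE m0 ltn0 andbF.
  pose f (i : 'I_n) : 'I_m := insubd (Ordinal mpos) (rank i).
  rewrite -[X in _ <= X]card_ord -(@card_in_imset _ _ f) ?max_card //.
  move=> i j; rewrite !inE => /andP[iP im] /andP[jP jm] e; apply: rank_inj => //=.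
  by have := congr1 val e; rewrite /= !val_insubd im jm.
apply/eqP; rewrite eqn_leq le1 /=.
case: (posnP (minn #|P| m)) => [->//|mpos].
have h (r : 'I_(minn #|P| m)) : exists i : 'I_n, (i \in P) && (rank i == r).
  have : r < #|P| by apply: leq_trans (ltn_ord r) (geq_minl _ _).
  by case/rank_surj => i iP e; exists i; rewrite iP e eqxx.
pose g r := xchoose (h r).
have gP r : g r \in P /\ rank (g r) = r :> nat.
  by case/andP: (xchooseP (h r)) => ? /eqP.
have gi : injective g.
  by move=> r r' e; apply/val_inj; rewrite /= -(gP r).2 e (gP r').2.
rewrite -[X in X <= _](card_ord (minn #|P| m)) -(card_imset _ gi); apply: subset_leq_card.
apply/subsetP => _ /imsetP[r _ ->]; rewrite inE (gP r).1 (gP r).2 /=.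
exact: leq_trans (ltn_ord r) (geq_minr _ _).
Qed.

End Rank.

(** * Twin classes and forced clusters *)

Section Kernel.
Variables (n : nat) (a : rel 'I_n) (k : nat).
Hypotheses (a_refl : reflexive a) (a_sym : symmetric a).
Implicit Types (S : {set 'I_n}) (l : 'I_n -> nat) (i j u v x y z : 'I_n).

Definition twin i j : bool := [forall w, a i w == a j w].
Definition class i : {set 'I_n} := [set j | twin i j].
Definition deg S i : nat := #|[set j in S | a i j]|.

Lemma twinP i j : reflect (forall w, a i w = a j w) (twin i j).
Proof. by apply: (iffP forallP) => h w; apply/eqP. Qed.

Lemma twin_refl i : twin i i. Proof. by apply/twinP. Qed.

Lemma twin_sym : symmetric twin.
Proof. by move=> i j; apply/twinP/twinP => h w; rewrite h. Qed.

Lemma twin_trans : transitive twin.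
Proof. by move=> j i u /twinP h /twinP h'; apply/twinP => w; rewrite h. Qed.

Lemma twin_nbrl i j : twin i j -> a i =1 a j.
Proof. by move/twinP. Qed.

Lemma twin_nbrr i j w : twin i j -> a w i = a w j.
Proof. by move/twinP => h; rewrite a_sym h a_sym. Qed.

Lemma twin_nbr i j : twin i j -> a i j.
Proof. by move/twinP/(_ j) => ->. Qed.

Lemma class_eq i j : twin i j -> class i = class j.
Proof.
move=> h; apply/setP => u; rewrite !inE; apply/idP/idP; last exact: twin_trans.
by apply: twin_trans; rewrite twin_sym.
Qed.

Lemma class_gt0 i : 0 < #|class i|.
Proof. by apply/card_gt0P; exists i; rewrite inE twin_refl. Qed.

(** One more than the bound of [card_cluster_rest]: a forced cluster that loses vertices by trimming
    remains larger than every cluster inside [rest]. *)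
Definition width := (4 * k).+1.
Definition large : {set 'I_n} := [set i | k.*2 < #|class i|].
Definition rest : {set 'I_n} := [set i | [forall j, (j \in large) ==> ~~ a i j]].
Definition crank i : nat := rank (class i) i.
Definition trimmed : {set 'I_n} := [set i | crank i < width].
Definition csize i : nat := minn #|class i| width.

(** Shared by the full vertex set and by [trimmed], so that the structure of solutions is
    established once for both. *)
Definition faithful S := forall i, csize i <= #|class i :&: S|.

Lemma card_class_trimmed i : #|class i :&: trimmed| = csize i.
Proof.
rewrite /csize -card_rank_lt; apply: eq_card => j; rewrite !inE.
case h: (twin i j) => //=; congr (_ < _).
by rewrite /crank (class_eq h).
Qed.

Lemma faithful_trimmed : faithful trimmed.
Proof. by move=> i; rewrite card_class_trimmed. Qed.

Lemma faithfulT : faithful [set: 'I_n].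
Proof. by move=> i; rewrite setIT geq_minl. Qed.

Section Solution.
Variables (S : {set 'I_n}) (eta : nat) (l : 'I_n -> nat).
Hypotheses (fS : faithful S) (sol : solution a S k eta l).
Let T := touched a S l.

Lemma faithful_rep i : exists2 j, j \in S & twin i j.
Proof.
have : 0 < #|class i :&: S|.
  by apply: leq_trans (fS i); rewrite leq_min class_gt0.
by case/card_gt0P => j; rewrite !inE => /andP[]; exists j.
Qed.

(** Every vertex has a twin in [S], so neighbourhoods need comparing only there. *)
Lemma faithful_twin u v : {in S, forall w, a u w = a v w} -> twin u v.
Proof.
move=> h; apply/twinP => w; have [w' w'S tw] := faithful_rep w.
by rewrite !(twin_nbrr _ tw) h.
Qed.

(** Both the class size and [width] exceed [k.*2], so the class meets [S] in more vertices than can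
    be touched. *)
Lemma large_untouched i : i \in large -> exists u, [/\ u \in S, u \notin T & twin i u].
Proof.
rewrite inE => iL; have : ~~ (class i :&: S \subset T).
  apply/negP => /subset_leq_card; rewrite leqNgt => /negP; apply.
  apply: leq_ltn_trans (card_touched sol) _; apply: leq_trans (fS i).
  by rewrite leq_min iL /= /width; lia.
by case/subsetPn => u; rewrite !inE => /andP[iu uS] uT; exists u.
Qed.

Lemma cluster_untouched u x : u \in S -> u \notin T -> x \in S -> a u x ->
  cluster S l x = [set z in S | a u z].
Proof.
move=> uS uT xS; rewrite -(untouched_label uS xS uT) => /eqP ux.
apply/setP => z; rewrite !inE; case zS : (z \in S) => //=.
by rewrite -ux eq_sym (untouched_label uS zS uT).
Qed.

(** An untouched twin [u] of [i] is adjacent to [x], hence in its cluster, and the cluster of an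
    untouched vertex is its neighbourhood within [S]. *)
Lemma cluster_large i x : i \in large -> x \in S -> a i x ->
  cluster S l x = [set z in S | a i z].
Proof.
move=> /large_untouched[u [uS uT tw]] xS; rewrite (twin_nbrl tw) => ux.
rewrite (cluster_untouched uS uT xS ux); apply/setP => z.
by rewrite !inE (twin_nbrl tw).
Qed.

Lemma large_cluster i : i \in large -> exists2 x, x \in S & cluster S l x = [set z in S | a i z].
Proof.
move=> iL; have [u [uS _ tw]] := large_untouched iL.
by exists u => //; apply: cluster_large => //; apply: twin_nbr.
Qed.

Lemma restPn x : x \notin rest -> exists2 i, i \in large & a i x.
Proof.
by rewrite inE => /forallPn[i]; rewrite negb_imply negbK a_sym => /andP[? ?]; exists i.
Qed.

Lemma rest_large x i : x \in rest -> i \in large -> a i x = false.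
Proof. by rewrite inE => /forallP/(_ i) /implyP h /h; rewrite a_sym => /negbTE. Qed.

(** A vertex outside [rest] lies in a forced cluster, and forced clusters contain no vertex of
    [rest]. *)
Lemma cluster_rest x : x \in S -> x \in rest -> cluster S l x \subset rest.
Proof.
move=> xS xR; apply/subsetP => z; rewrite inE => /andP[zS /eqP zx].
apply: contraT => /restPn[i iL iz].
have /setP/(_ x) := cluster_large iL zS iz.
by rewrite !inE xS zx eqxx (rest_large xR).
Qed.

(** At most [k.*2] members are touched. The untouched ones share their neighbourhood within [S], so
    they are twins, and their class is not large, which leaves at most [k.*2] of them. *)
Lemma card_cluster_rest x : x \in S -> x \in rest -> #|cluster S l x| <= 4 * k.
Proof.
move=> xS xR; rewrite -(cardsID T); have -> : 4 * k = k.*2 + k.*2 by lia.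
apply: leq_add; first exact: leq_trans (subset_leq_card (subsetIr _ _)) (card_touched sol).
case: (set_0Vmem (cluster S l x :\: T)) => [->|[u]]; first by rewrite cards0.
rewrite inE => /andP[uT uC].
have uR := subsetP (cluster_rest xS xR) _ uC.
move: uC; rewrite inE => /andP[uS /eqP ux].
have uL : u \notin large.
  by apply/negP => /(rest_large uR); rewrite a_refl.
apply: leq_trans (_ : #|class u| <= _); last by rewrite inE -leqNgt in uL.
apply: subset_leq_card; apply/subsetP => v; rewrite !inE => /and3P[vT vS /eqP vx].
apply: faithful_twin => w wS.
by rewrite -(untouched_label uS wS uT) -(untouched_label vS wS vT) ux vx.
Qed.

End Solution.

(** No cluster exceeds [n] vertices, so imbalance [n] makes the balance condition vacuous. The
    structure of solutions thus becomes available from the edit bound alone. *)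
Lemma card_mismatches_solution S l : #|mismatches a S l| <= k.*2 -> solution a S k n l.
Proof.
move=> h; split=> // x y _ _; apply: leq_trans (leq_addl _ _).
by rewrite -[X in _ <= X]card_ord max_card.
Qed.

(** * Effect of trimming on edits and balance *)

Lemma notin_trimmed i : i \notin trimmed -> width < #|class i|.
Proof.
rewrite inE -leqNgt => /leq_ltn_trans; apply; apply: rank_lt_card.
by rewrite inE twin_refl.
Qed.

Lemma notin_trimmed_large i : i \notin trimmed -> i \in large.
Proof. by move/notin_trimmed; rewrite inE /width; lia. Qed.

Lemma rest_sub_trimmed : rest \subset trimmed.
Proof.
apply/subsetP => x xR; apply: contraT => /notin_trimmed_large /(rest_large xR).
by rewrite a_refl.
Qed.

(** Each removed vertex takes the label of an untouched twin that was retained, and therefore enters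
    no mismatch. *)
Lemma extend_trimmed l : #|mismatches a trimmed l| <= k.*2 ->
  exists2 l', #|mismatches a [set: 'I_n] l'| <= k.*2 & {in trimmed, l' =1 l}.
Proof.
move=> lk; have sol := card_mismatches_solution lk.
pose good v u := [&& u \in trimmed, u \notin touched a trimmed l & twin v u].
(* The default of [odflt] never arises: a removed vertex lies in a large class, which has an
   untouched member in [trimmed]. *)
pose pi v := if v \in trimmed then v else odflt v [pick u | good v u].
have piP v : v \notin trimmed -> good v (pi v).
  move=> vS; rewrite /pi (negbTE vS); case: pickP => //= none.
  have [u [uS uT tw]] := large_untouched faithful_trimmed sol (notin_trimmed_large vS).
  by have := none u; rewrite /good uS uT tw.
have pi_id v : v \in trimmed -> pi v = v by rewrite /pi => ->.
have piS v : pi v \in trimmed.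
  by case vS: (v \in trimmed); [rewrite pi_id | case/and3P: (piP v (negbT vS))].
have pitw v : twin v (pi v).
  case vS: (v \in trimmed); first by rewrite pi_id ?twin_refl.
  by case/and3P: (piP v (negbT vS)).
exists (l \o pi); last by move=> x xS /=; rewrite pi_id.
apply: leq_trans lk; apply: subset_leq_card; apply/subsetP => -[x y].
rewrite inE /= !in_setT /= (twin_nbrl (pitw x)) (twin_nbrr _ (pitw y)) => h.
have xS : x \in trimmed.
  apply: contraLR h => /piP/and3P[_ xT _].
  by rewrite (untouched_label (piS x) (piS y) xT) eqxx.
have yS : y \in trimmed.
  apply: contraLR h => /piP/and3P[_ yT _].
  by rewrite (eq_sym (l _)) a_sym (untouched_label (piS y) (piS x) yT) eqxx.
by move: h; rewrite !pi_id // => h; rewrite inE /= xS yS.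
Qed.

(** In a solution on a faithful [S], this is the size of the largest forced cluster, by
    [large_cluster]; it is 0 if no class is large. *)
Definition maxdeg S : nat := \max_(i in large) deg S i.
Definition shrink : nat := maxdeg [set: 'I_n] - maxdeg trimmed.

Lemma maxdeg_ge S i : i \in large -> deg S i <= maxdeg S.
Proof. by move=> iL; apply: (leq_bigmax_cond (F := deg S)). Qed.

Lemma maxdeg_attained S i : i \in large -> exists2 j, j \in large & maxdeg S = deg S j.
Proof.
move=> iL; have L0 : 0 < #|large| by apply/card_gt0P; exists i.
by have [j jL ej] := eq_bigmax_cond (deg S) L0; exists j.
Qed.

Lemma deg_trimmed i : deg trimmed i <= deg [set: 'I_n] i.
Proof.
by apply: subset_leq_card; apply/subsetP => j; rewrite !inE => /andP[_ ->].
Qed.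

(** Either no neighbour of [i] was removed, or the whole class of a removed neighbour is adjacent to
    [i], and [width] of its members remain. *)
Lemma deg_trimmed_eq i : deg trimmed i = deg [set: 'I_n] i \/ width <= deg trimmed i.
Proof.
case: (boolP [forall j, a i j ==> (j \in trimmed)]) => [/forallP h|].
  left; apply: eq_card => j; rewrite !in_set /=.
  by have := h j; rewrite inE; case: (a i j); rewrite ?andbF //= => ->.
case/forallPn => j; rewrite negb_imply => /andP[aij /notin_trimmed jW]; right.
have <- : csize j = width by apply/minn_idPr/ltnW.
rewrite -card_class_trimmed; apply: subset_leq_card; apply/subsetP => u.
by rewrite !inE => /andP[ju ->]; rewrite -(twin_nbrr _ ju).
Qed.

Lemma maxdeg_trimmed : maxdeg trimmed <= maxdeg [set: 'I_n].
Proof.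
apply/bigmax_leqP => i iL; exact: leq_trans (deg_trimmed i) (maxdeg_ge _ iL).
Qed.

Lemma shrink_gt0 : 0 < shrink -> width <= maxdeg trimmed.
Proof.
move=> h; have [e|[i iL]] := set_0Vmem large.
  by move: h; rewrite /shrink /maxdeg !big_pred0 // => i; rewrite e inE.
have [j jL e] := maxdeg_attained [set: 'I_n] iL.
have := maxdeg_ge trimmed jL; have [e'|] := deg_trimmed_eq j; last exact: leq_trans.
by move: h; rewrite /shrink e -e'; lia.
Qed.

Section Trim.
Variables (l : 'I_n -> nat).
Hypothesis lk : #|mismatches a [set: 'I_n] l| <= k.*2.

Lemma mismatches_trimmed : #|mismatches a trimmed l| <= k.*2.
Proof. exact: leq_trans (sub_mismatches _ _ (subsetT _)) lk. Qed.

Let solT := card_mismatches_solution lk.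
Let solS := card_mismatches_solution mismatches_trimmed.

Lemma cluster_rest_trimmed x : x \in rest -> cluster [set: 'I_n] l x = cluster trimmed l x.
Proof.
move=> xR; apply/setP => z; apply/idP/idP => [zC|]; last by rewrite !inE => /andP[_ ->].
have zR := subsetP (cluster_rest faithfulT solT (in_setT x) xR) _ zC.
by move: zC; rewrite inE inE => /= zx; rewrite inE zx (subsetP rest_sub_trimmed).
Qed.

Lemma trim_rest_balanced eta : rest != set0 ->
  {in [set: 'I_n] &, forall x y, #|cluster [set: 'I_n] l x| <= #|cluster [set: 'I_n] l y| + eta} <->
  shrink <= eta /\
  {in trimmed &, forall x y,
     #|cluster trimmed l x| <= #|cluster trimmed l y| + (eta - shrink)}.
Proof.
case/set0Pn => r rR; have rS := subsetP rest_sub_trimmed _ rR.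
have ub x := card_cluster_rest faithfulT solT (in_setT x).
have mT := maxdeg_trimmed.
have upS x : x \in trimmed -> exists y, #|cluster trimmed l x| + shrink <= #|cluster [set: 'I_n] l y|.
  move=> xS; case xR: (x \in rest).
    rewrite -cluster_rest_trimmed //; case: (posnP shrink) => [->|s0].
      by exists x; rewrite addn0.
    (* The cluster of [x] has at most [4 * k < width <= maxdeg trimmed] vertices, so even with
       [shrink] added it stays below the largest untrimmed forced cluster. *)
    have := shrink_gt0 s0; have := ub x xR.
    have [e|[i iL]] := set_0Vmem large.
      by move: s0; rewrite /shrink /maxdeg !big_pred0 // => i; rewrite e inE.
    have [j jL ej] := maxdeg_attained [set: 'I_n] iL.
    have [y _ ey] := large_cluster faithfulT solT jL.
    by move=> h1 h2; exists y; rewrite ey -/(deg _ _) -ej; move: s0 h1 h2; rewrite /shrink /width; lia.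
  have [i iL ix] := restPn (negbT xR).
  have [j jL ej] := maxdeg_attained [set: 'I_n] iL.
  have [y _ ey] := large_cluster faithfulT solT jL.
  exists y; rewrite ey (cluster_large faithful_trimmed solS iL xS ix) -!/(deg _ _) -ej.
  by have := maxdeg_ge trimmed iL; rewrite /shrink; lia.
have loS x : x \in trimmed -> exists y, #|cluster [set: 'I_n] l y| <= #|cluster trimmed l x|.
  move=> xS; case xR: (x \in rest).
    by exists x; rewrite cluster_rest_trimmed.
  have [i iL ix] := restPn (negbT xR).
  rewrite (cluster_large faithful_trimmed solS iL xS ix) -/(deg _ _).
  case: (deg_trimmed_eq i) => [->|h].
    by have [y _ ey] := large_cluster faithfulT solT iL; exists y; rewrite ey.
  by exists r; apply: leq_trans h; apply: leq_trans (ub r rR) _; rewrite /width; lia.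
have upT x : exists2 y, y \in trimmed & #|cluster [set: 'I_n] l x| <= #|cluster trimmed l y| + shrink.
  case xR: (x \in rest).
    by exists x; [exact: (subsetP rest_sub_trimmed) | rewrite cluster_rest_trimmed // leq_addr].
  have [i iL ix] := restPn (negbT xR).
  have [j jL ej] := maxdeg_attained trimmed iL.
  have [y yS ey] := large_cluster faithful_trimmed solS jL.
  exists y => //; rewrite ey (cluster_large faithfulT solT iL (in_setT x) ix) -!/(deg _ _) -ej.
  by have := maxdeg_ge [set: 'I_n] iL; rewrite /shrink; lia.
have loT x : exists2 y, y \in trimmed & #|cluster trimmed l y| <= #|cluster [set: 'I_n] l x|.
  case xR: (x \in rest).
    by exists x; [exact: (subsetP rest_sub_trimmed) | rewrite cluster_rest_trimmed].
  have [i iL ix] := restPn (negbT xR).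
  have [y yS ey] := large_cluster faithful_trimmed solS iL.
  exists y => //; rewrite ey (cluster_large faithfulT solT iL (in_setT x) ix) -!/(deg _ _).
  exact: deg_trimmed.
split=> [bal|[le bal] x y _ _].
  have main x y : x \in trimmed -> y \in trimmed ->
      #|cluster trimmed l x| + shrink <= #|cluster trimmed l y| + eta.
    move=> /upS[x' hx] /loS[y' hy].
    apply: leq_trans hx _; apply: leq_trans (bal x' y' (in_setT _) (in_setT _)) _.
    by rewrite leq_add2r.
  have le : shrink <= eta by have := main r r rS rS; rewrite leq_add2l.
  by split=> // x y xS yS; have := main x y xS yS; lia.
have [x' x'S hx] := upT x; have [y' y'S hy] := loT y.
by have := bal x' y' x'S y'S; lia.
Qed.

(** With [rest] empty, every cluster is forced and its size is the degree of a large vertex. *)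
Lemma trim_large_balanced eta : rest = set0 ->
  {in [set: 'I_n] &, forall x y, #|cluster [set: 'I_n] l x| <= #|cluster [set: 'I_n] l y| + eta} <->
  {in large &, forall i j, deg [set: 'I_n] i <= deg [set: 'I_n] j + eta}.
Proof.
move=> R0; split=> h x y.
  move=> /(large_cluster faithfulT solT)[x' x'S ex] /(large_cluster faithfulT solT)[y' y'S ey].
  by have := h x' y' x'S y'S; rewrite ex ey.
move=> _ _.
have [i iL ix] : exists2 i, i \in large & a i x by apply: restPn; rewrite R0 inE.
have [j jL jy] : exists2 i, i \in large & a i y by apply: restPn; rewrite R0 inE.
rewrite (cluster_large faithfulT solT iL (in_setT x) ix).
rewrite (cluster_large faithfulT solT jL (in_setT y) jy).
exact: h.
Qed.

End Trim.

Lemma eq_solution S eta l l' : {in S, l' =1 l} -> solution a S k eta l -> solution a S k eta l'.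
Proof.
move=> e.
have cE x : x \in S -> cluster S l' x = cluster S l x.
  by move=> xS; apply/setP => z; rewrite !inE; case zS: (z \in S) => //=; rewrite !e.
have mE : mismatches a S l' = mismatches a S l.
  apply/setP => -[x y]; rewrite !inE /=.
  by case xS: (x \in S) => //=; case yS: (y \in S) => //=; rewrite !e.
by case=> h1 h2; split; rewrite ?mE // => x y xS yS; rewrite !cE //; apply: h2.
Qed.

Lemma editable_trim_rest eta : rest != set0 ->
  editable a [set: 'I_n] k eta <-> shrink <= eta /\ editable a trimmed k (eta - shrink).
Proof.
move=> R0; split=> [[l [lk /(trim_rest_balanced lk _ R0)[le bal]]]|[le [l sl]]].
  by split=> //; exists l; split=> //; apply: mismatches_trimmed.
have [l' lk e] := extend_trimmed sl.1.
exists l'; split=> //; apply/(trim_rest_balanced lk _ R0); split=> //.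
by case: (eq_solution e sl).
Qed.

(** Balance has become a condition on the input alone, so the trimmed instance only has to control
    the number of edits; imbalance [n] achieves this. *)
Lemma editable_trim_large eta : rest = set0 ->
  editable a [set: 'I_n] k eta <->
  {in large &, forall i j, deg [set: 'I_n] i <= deg [set: 'I_n] j + eta} /\ editable a trimmed k n.
Proof.
move=> R0; split=> [[l [lk /(trim_large_balanced lk _ R0) bal]]|[bal [l sl]]].
  by split=> //; exists l; apply: card_mismatches_solution; apply: mismatches_trimmed.
have [l' lk e] := extend_trimmed sl.1.
by exists l'; split=> //; apply/(trim_large_balanced lk _ R0).
Qed.

Definition isolated i : bool := [forall j, a i j ==> twin i j].
Definition is_rep i : bool := crank i == 0.
Definition clique_reps s : {set 'I_n} :=
  [set u | [&& is_rep u, isolated u & csize u == s]].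
(** Requiring [u] to precede the whole class of [i] compares it with the representative of [i]
    without naming the latter; see [clique_rank_rep]. *)
Definition clique_rank i : nat :=
  #|[set u in clique_reps (csize i) | [forall w, twin i w ==> (u < w)]]|.
Definition kept : {set 'I_n} :=
  [set i in trimmed | isolated i ==> (clique_rank i <= k.*2)].

Lemma nbr_isolated i j : isolated i -> a i j = twin i j.
Proof. by move/forallP/(_ j)/implyP => h; apply/idP/idP => // /twin_nbr. Qed.

Lemma isolated_twin i j : twin i j -> isolated i = isolated j.
Proof.
move=> ij; apply/forallP/forallP => h u; have := h u.
  rewrite (twin_nbrl ij) => /implyP h'; apply/implyP => /h'.
  by apply: twin_trans; rewrite twin_sym.
by rewrite (twin_nbrl ij) => /implyP h'; apply/implyP => /h'; apply: twin_trans.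
Qed.

Lemma csize_twin i j : twin i j -> csize i = csize j.
Proof. by rewrite /csize => /class_eq ->. Qed.

Lemma clique_rank_twin i j : twin i j -> clique_rank i = clique_rank j.
Proof.
move=> ij; rewrite /clique_rank (csize_twin ij); apply: eq_card => u; rewrite !inE.
congr (_ && _); apply: eq_forallb => w; congr (_ ==> _).
by have := class_eq ij => /setP/(_ w); rewrite !inE.
Qed.

Lemma rep_min i j : is_rep i -> twin i j -> i <= j.
Proof.
rewrite /is_rep cards_eq0 leqNgt => /eqP/setP/(_ j); rewrite !inE => h tw.
by rewrite tw /= in h; rewrite h.
Qed.

Lemma rep_unique i j : is_rep i -> is_rep j -> twin i j -> i = j.
Proof.
move=> ri rj ij; apply/val_inj/eqP; rewrite eqn_leq /= (rep_min ri ij).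
by rewrite (rep_min rj) // twin_sym.
Qed.

Lemma rep_exists i : exists2 r, is_rep r & twin i r.
Proof.
case: (arg_minnP (fun j : 'I_n => nat_of_ord j) (twin_refl i)) => r ir rmin.
exists r => //; rewrite /is_rep cards_eq0 -subset0; apply/subsetP => j.
rewrite !inE => /andP[rj]; rewrite ltnNge => /negP; case; apply: rmin.
exact: twin_trans rj.
Qed.

Lemma clique_rank_rep i r : is_rep r -> twin i r ->
  clique_rank i = rank (clique_reps (csize r)) r.
Proof.
move=> rr ir; rewrite (clique_rank_twin ir); apply: eq_card => u; rewrite !inE.
congr (_ && _); apply/forallP/idP => [/(_ r)|ur w]; first by rewrite twin_refl.
by apply/implyP => /(rep_min rr); apply: leq_trans.
Qed.

(** Pigeonhole: the classes of the members of [U] are disjoint and more numerous than the touched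
    vertices. *)
Lemma class_untouched S eta l (U : {set 'I_n}) : solution a S k eta l ->
  {in U &, forall u u', twin u u' -> u = u'} -> k.*2 < #|U| ->
  exists2 u, u \in U & {in class u, forall x, x \notin touched a S l}.
Proof.
move=> sol Uinj Uk.
case: (boolP [exists u in U, [forall x, twin u x ==> (x \notin touched a S l)]]).
  case/existsP=> u /andP[uU /forallP h]; exists u => // x; rewrite inE => tw.
  exact: implyP (h x) tw.
move/existsPn => h; exfalso.
(* If every class were touched, choosing a touched vertex in each would inject [U] into the touched
   set. *)
pose f u := odflt u [pick x | twin u x && (x \in touched a S l)].
have fP u : u \in U -> twin u (f u) && (f u \in touched a S l).
  move=> uU; rewrite /f; case: pickP => //= none.
  have := h u; rewrite uU /= => /forallPn[x]; rewrite negb_imply negbK.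
  by rewrite none.
have fi : {in U &, injective f}.
  move=> u u' uU u'U e; apply: Uinj => //.
  have /andP[h1 _] := fP u uU; have /andP[h2 _] := fP u' u'U.
  by apply: twin_trans h1 _; rewrite e twin_sym.
move: Uk; rewrite ltnNge => /negP; apply; apply: leq_trans (card_touched sol).
rewrite -(card_in_imset fi); apply: subset_leq_card; apply/subsetP => _ /imsetP[u uU ->].
by case/andP: (fP u uU).
Qed.

Lemma cluster_isolated S l u x : isolated u -> x \in S -> twin u x ->
  x \notin touched a S l -> cluster S l x = class u :&: S.
Proof.
move=> iu xS ux xT; rewrite (cluster_untouched xS xT xS) //; apply/setP => z.
by rewrite !inE -(twin_nbrl ux) nbr_isolated // andbC.
Qed.

Lemma nbr_isolated_class u x y : isolated u -> twin u x -> a x y = twin u y.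
Proof. by move=> iu ux; rewrite -(twin_nbrl ux) nbr_isolated. Qed.

Section DropClique.
Variables (S U : {set 'I_n}) (v : 'I_n) (eta : nat).
Hypotheses (vS : v \in S) (v_iso : isolated v) (U_card : k.*2 < #|U|).
Hypothesis U_inj : {in U &, forall u u', twin u u' -> u = u'}.
Hypothesis U_iso : {in U, forall u, isolated u}.
Hypothesis U_size : {in U, forall u, #|class u :&: S| = #|class v :&: S|}.
Hypothesis U_v : {in U, forall u, twin u v = false}.

Lemma class_disjoint u x : u \in U -> twin u x -> twin v x = false.
Proof.
move=> uU ux; apply/negP => vx; have := U_v uU.
by rewrite (twin_trans ux) // twin_sym.
Qed.

(** Matching the two cliques in the order of their enumerations and fixing all other vertices is an
    isomorphism. *)
Lemma swap_clique u : u \in U ->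
  editable a (S :\: class v) k eta <-> editable a (S :\: class u) k eta.
Proof.
move=> uU; have uI := U_iso uU.
pose A := enum (class u :&: S); pose B := enum (class v :&: S).
have AB : size A = size B by rewrite -!cardE U_size.
have inA x : (x \in A) = twin u x && (x \in S) by rewrite mem_enum !inE.
have inB x : (x \in B) = twin v x && (x \in S) by rewrite mem_enum !inE.
(* The default of [nth] is immaterial because [A] and [B] have equal size. *)
pose phi x := if x \in A then nth x B (index x A) else x.
have phiA x : x \in A -> phi x \in B.
  by move=> xA; rewrite /phi xA mem_nth // -AB index_mem.
have phiN x : x \notin A -> phi x = x by rewrite /phi => /negbTE ->.
have inS x : x \in S :\: class v -> (x \in S) * (twin v x = false).
  by rewrite !inE => /andP[/negbTE -> ->].
have phi_inj : {in S :\: class v &, injective phi}.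
  move=> x y /inS[xS xv] /inS[yS yv].
  case: (boolP (x \in A)) => xA; case: (boolP (y \in A)) => yA.
  - rewrite /phi xA yA (set_nth_default y) -?AB ?index_mem // => /eqP.
    by rewrite nth_uniq -?AB ?index_mem ?enum_uniq // => /eqP; apply: index_inj.
  - by move: (phiA x xA); rewrite inB => + e; rewrite e phiN // yv.
  - by move: (phiA y yA); rewrite inB => + e; rewrite -e phiN // xv.
  - by rewrite !phiN.
apply: (@editable_transport _ _ a a _ _ phi k eta phi_inj).
  apply/eqP; rewrite eqEcard; apply/andP; split.
    apply/subsetP => _ /imsetP[x /inS[xS xv] ->].
    case: (boolP (x \in A)) => xA.
      have := phiA x xA; rewrite inB !inE => /andP[vp ->]; rewrite andbT.
      by apply/negP => /(class_disjoint uU); rewrite vp.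
    by rewrite phiN // !inE xS; move: xA; rewrite inA xS andbT => ->.
  rewrite card_in_imset // !cardsD ![S :&: _]setIC U_size //.
move=> x y /inS[xS xv] /inS[yS yv].
have ntw x' y' : twin u x' -> twin u y' = false -> (a x' y' = false) * (a y' x' = false).
  by move=> h h'; split; rewrite ?[a y' x']a_sym (nbr_isolated_class _ uI h).
have ntv x' y' : twin v x' -> twin v y' = false -> (a x' y' = false) * (a y' x' = false).
  by move=> h h'; split; rewrite ?[a y' x']a_sym (nbr_isolated_class _ v_iso h).
case: (boolP (x \in A)) => xA; case: (boolP (y \in A)) => yA.
- have := phiA x xA; have := phiA y yA; rewrite !inB => /andP[h1 _] /andP[h2 _].
  rewrite (nbr_isolated_class _ v_iso h2) h1.
  by move: xA yA; rewrite !inA => /andP[h3 _] /andP[h4 _]; rewrite (nbr_isolated_class _ uI h3).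
- have := phiA x xA; rewrite inB => /andP[h1 _]; rewrite (phiN y) // (ntv _ _ h1 yv).1.
  by move: xA yA; rewrite !inA yS andbT => /andP[h3 _] /negbTE h4; rewrite (ntw _ _ h3 h4).1.
- have := phiA y yA; rewrite inB => /andP[h1 _]; rewrite (phiN x) // (ntv _ _ h1 xv).2.
  by move: xA yA; rewrite !inA xS andbT => /negbTE h4 /andP[h3 _]; rewrite (ntw _ _ h3 h4).2.
- by rewrite !phiN.
Qed.

(** Some clique from [U] is untouched and hence a cluster by itself. Going down, that clique is
    deleted and then exchanged for the one of [v]; going up, the clique of [v] is added as a new
    cluster of a size that already occurs. *)
Lemma drop_clique : editable a S k eta <-> editable a (S :\: class v) k eta.
Proof.
split=> [[l sol]|[l sol]].
  have [u uU uT] := class_untouched sol U_inj U_card.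
  apply/(swap_clique uU); exists l; split.
    by apply: leq_trans sol.1; apply: sub_mismatches; apply: subsetDl.
  (* The class of [u] is a whole cluster, so deleting it changes no other. *)
  have cE x : x \in S :\: class u -> cluster (S :\: class u) l x = cluster S l x.
    rewrite !inE => /andP[xu xS]; apply/setP => z; rewrite !inE.
    case zS: (z \in S); rewrite ?andbF //= andbT andb_idl // => /eqP zx.
    apply: contra xu => zu; have zT := uT z; rewrite inE in zT.
    have := cluster_isolated (U_iso uU) zS zu (zT zu).
    by move/setP/(_ x); rewrite !inE xS zx eqxx !andbT => /esym ->.
  move=> x y xS yS; rewrite !cE //; apply: sol.2.
    exact: (subsetP (subsetDl _ _) _ xS).
  exact: (subsetP (subsetDl _ _) _ yS).
have [u uU uT] := class_untouched sol U_inj U_card.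
set S' := S :\: class v in sol uT *.
have S'P x : (x \in S') = ~~ twin v x && (x \in S) by rewrite !inE.
(* Shifting the old labels by one frees 0 for the clique of [v]. *)
pose l' z := if twin v z then 0 else (l z).+1.
have aE x y : twin v x -> a x y = twin v y by apply: nbr_isolated_class.
have lv x : twin v x -> cluster S l' x = class v :&: S.
  move=> vx; apply/setP => z; rewrite !inE /l' vx andbC.
  by case: (twin v z).
have ln x : twin v x = false -> cluster S l' x = cluster S' l x.
  move=> vx; apply/setP => z; rewrite !inE /l' vx.
  by case: (twin v z); rewrite ?andbF //= eqSS.
have reach x : x \in S -> exists2 x', x' \in S' & #|cluster S l' x| = #|cluster S' l x'|.
  case vx: (twin v x); last by move=> xS; exists x; rewrite ?S'P ?vx ?ln.
  move=> _; have : 0 < #|class u :&: S|.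
    by rewrite U_size //; apply/card_gt0P; exists v; rewrite !inE twin_refl.
  case/card_gt0P => w; rewrite !inE => /andP[uw wS].
  have wS' : w \in S' by rewrite S'P wS (class_disjoint uU uw).
  exists w => //; rewrite lv // -(U_size uU) (cluster_isolated (U_iso uU) wS' uw); last first.
    by apply: uT; rewrite inE.
  apply: eq_card => z; rewrite !inE; case uz: (twin u z) => //=.
  by rewrite (class_disjoint uU uz).
exists l'; split; last first.
  by move=> x y /reach[x' x'S ->] /reach[y' y'S ->]; apply: sol.2.
apply: leq_trans sol.1; apply: subset_leq_card; apply/subsetP => -[x y].
rewrite ![_ \in mismatches _ _ _]inE /= !S'P /l' => /and3P[-> ->]; rewrite !andbT.
case vx: (twin v x); first by rewrite aE //; case: (twin v y).
by case vy: (twin v y); rewrite //= a_sym aE // vx.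
Qed.

End DropClique.

Lemma twin_kept i j : twin i j -> j \in trimmed -> i \in kept -> j \in kept.
Proof.
move=> ij jt; rewrite inE => /andP[_]; rewrite (isolated_twin ij) (clique_rank_twin ij).
by move=> h; rewrite inE jt.
Qed.

Lemma editable_kept eta : editable a trimmed k eta <-> editable a kept k eta.
Proof.
(* The last condition keeps [S] a union of trimmed classes, so that each class it meets has its full
   trimmed size in [S]. *)
suff main m S : #|S :\: kept| <= m -> kept \subset S -> S \subset trimmed ->
    (forall x y, x \in S -> y \in trimmed -> twin x y -> y \in S) ->
    editable a S k eta <-> editable a kept k eta.
  apply: (main #|trimmed :\: kept|) => //.
  by apply/subsetP => x; rewrite inE => /andP[].
elim: m S => [|m IH] S Sm kS St Sc.
  suff -> : S = kept by [].
  apply/eqP; rewrite eqEsubset kS andbT -setD_eq0 -cards_eq0; lia.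
have [e|[v]] := set_0Vmem (S :\: kept).
  suff -> : S = kept by [].
  by apply/eqP; rewrite eqEsubset kS andbT -setD_eq0 e.
rewrite inE => /andP[vk vS]; have vt := subsetP St _ vS.
have [v_iso v_rank] : isolated v /\ k.*2 < clique_rank v.
  by move: vk; rewrite inE vt /= negb_imply -ltnNge => /andP[].
(* These are the first [k.*2.+1] representatives of cliques of the trimmed size of [v]; the rank of
   [v] ensures that there are so many, and that [v] belongs to none of them. *)
pose U := [set u in clique_reps (csize v) | rank (clique_reps (csize v)) u < k.*2.+1].
have UP u : u \in U -> [/\ is_rep u, isolated u, csize u = csize v & clique_rank u <= k.*2].
  rewrite inE [u \in _]inE => /andP[/and3P[ru iu /eqP su]].
  by rewrite -su -(clique_rank_rep ru (twin_refl u)).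
have UK u : u \in U -> u \in kept.
  case/UP=> ru iu su cu; rewrite inE cu implybT andbT inE.
  by move: ru; rewrite /is_rep => /eqP ->.
have cS u : u \in S -> #|class u :&: S| = csize u.
  move=> uS; rewrite -card_class_trimmed; apply: eq_card => z; rewrite inE [RHS]inE.
  case uz: (z \in class u) => //=; rewrite inE in uz; apply/idP/idP => [/(subsetP St)//|zt].
  exact: Sc uz.
have drop := @drop_clique S U v eta vS v_iso.
rewrite drop; first last.
- move=> u /UP[_ _ _ cu]; apply/negP => /clique_rank_twin e.
  by move: v_rank; rewrite -e ltnNge cu.
- by move=> u uU; rewrite !cS // ?(subsetP kS) ?UK //; case: (UP _ uU).
- by move=> u /UP[].
- by move=> u u' /UP[? _ _ _] /UP[? _ _ _]; apply: rep_unique.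
- rewrite card_rank_lt leq_min leqnn andbT; apply: leq_trans v_rank _.
  by apply: subset_leq_card; apply/subsetP => u; rewrite !inE => /andP[].
apply: IH.
- rewrite -ltnS; apply: leq_trans Sm; apply: proper_card; apply/properP; split.
    by apply: setSD; apply: subsetDl.
  by exists v; rewrite !in_setD vk vS // in_set twin_refl.
- apply/subsetP => x xk; rewrite in_setD (subsetP kS) // andbT inE.
  by apply: contra vk => vx; apply: twin_kept vt xk; rewrite twin_sym.
- exact: subset_trans (subsetDl _ _) St.
- move=> x y; rewrite !in_setD ![_ \in class v]inE => /andP[vx xS] yt xy.
  by rewrite (Sc x) // andbT; apply: contra vx => /twin_trans; apply; rewrite twin_sym.
Qed.

(** * Counting the kept vertices *)

Definition mixed_reps : {set 'I_n} := [set i | is_rep i & ~~ isolated i].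

(** Adjacent untouched vertices are twins, so an untouched representative of a non-isolated class
    has a touched neighbour. Two untouched vertices with a common touched neighbour lie in one
    cluster and are twins, so choosing such neighbours is injective. *)
Lemma card_mixed_reps eta : editable a [set: 'I_n] k eta -> #|mixed_reps| <= 4 * k.
Proof.
case=> l sol; pose T := touched a [set: 'I_n] l.
have lE x y : x \notin T -> (l x == l y) = a x y.
  by apply: untouched_label; rewrite inE.
rewrite -(cardsID T); have -> : 4 * k = k.*2 + k.*2 by lia.
apply: leq_add; first exact: leq_trans (subset_leq_card (subsetIr _ _)) (card_touched sol).
apply: leq_trans (card_touched sol).
pose f i := odflt i [pick j | a i j && (j \in T)].
have fP i : i \in mixed_reps :\: T -> a i (f i) && (f i \in T).
  rewrite !in_setD inE => /and3P[iT _]; rewrite /f; case: pickP => //= none.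
  case/forallPn => j; rewrite negb_imply => /andP[ij].
  case/negP; have := none j; rewrite ij /= => /negbT jT.
  move: ij; rewrite -lE // => /eqP ij.
  by apply/twinP => w; rewrite -!lE // ij.
rewrite -(@card_in_imset _ _ f); first last.
  move=> i j ip jp e; have /andP[ai _] := fP i ip; have /andP[aj _] := fP j jp.
  move: ip jp; rewrite !in_setD !inE => /and3P[iT ri _] /and3P[jT rj _].
  apply: rep_unique => //; apply/twinP => w; rewrite -!lE //.
  move: ai aj; rewrite -e -!lE // => /eqP ei /eqP ej.
  by rewrite ei ej.
by apply: subset_leq_card; apply/subsetP => _ /imsetP[i /fP/andP[_ fi] ->].
Qed.

Lemma crank_inj i j : twin i j -> crank i = crank j -> i = j.
Proof.
move=> ij; rewrite /crank -(class_eq ij); apply: rank_inj.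
  by rewrite inE twin_refl.
by rewrite inE.
Qed.

(** A kept isolated vertex is determined by the trimmed size of its clique, the rank of the clique
    and its rank in the clique; any other kept vertex by its representative and its rank in the
    class. *)
Lemma card_kept : #|mixed_reps| <= 4 * k -> #|kept| <= 200 * (k ^ 3 + 1).
Proof.
move=> mk; rewrite -(cardsID [set i | isolated i]).
have kt i : i \in kept -> crank i < width by rewrite inE => /andP[]; rewrite inE.
have inord_inj (m p q : nat) : p < m.+1 -> q < m.+1 -> inord p = inord q :> 'I_m.+1 -> p = q.
  by move=> pm qm /(congr1 val); rewrite /= !inordK.
have isoP : #|kept :&: [set i | isolated i]| <= width.+1 * (k.*2.+1 * width).
  pose h i : 'I_width.+1 * ('I_k.*2.+1 * 'I_width) :=
    (inord (csize i), (inord (clique_rank i), inord (crank i))).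
  rewrite -(@card_in_imset _ _ h).
    by apply: leq_trans (max_card _) _; rewrite !card_prod !card_ord.
  move=> i j /setIP[ik]; rewrite inE => ii /setIP[jk]; rewrite inE => ij [] es ec er.
  have ck u : u \in kept -> isolated u -> clique_rank u < k.*2.+1.
    by rewrite inE => /andP[_ /implyP].
  have {}es : csize i = csize j by apply: inord_inj es; rewrite ltnS geq_minr.
  have {}ec : clique_rank i = clique_rank j by apply: inord_inj ec; apply: ck.
  have {}er : crank i = crank j by apply: inord_inj er; apply: kt.
  have [r rr ir] := rep_exists i; have [q rq jq] := rep_exists j.
  have rj : r = q.
    move: ec; rewrite (clique_rank_rep rr ir) (clique_rank_rep rq jq).
    rewrite -(csize_twin ir) -(csize_twin jq) -es => e; apply: rank_inj e; rewrite inE.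
      by rewrite rr -(isolated_twin ir) ii (csize_twin ir) eqxx.
    by rewrite rq -(isolated_twin jq) ij es (csize_twin jq) eqxx.
  apply: crank_inj er; apply: twin_trans ir _; rewrite rj twin_sym; exact: jq.
have mixP : #|kept :\: [set i | isolated i]| <= #|mixed_reps| * width.
  pose rep i := odflt i [pick r | is_rep r && twin i r].
  have repP i : is_rep (rep i) && twin i (rep i).
    rewrite /rep; case: pickP => //= none; have [r rr ir] := rep_exists i.
    by have := none r; rewrite rr ir.
  pose g i : 'I_n * 'I_width := (rep i, inord (crank i)).
  rewrite -(@card_in_imset _ _ g).
    rewrite -[X in _ * X]card_ord -cardsT -cardsX; apply: subset_leq_card.
    apply/subsetP => _ /imsetP[i + ->]; rewrite in_setD inE => /andP[ni _].
    have /andP[rr ir] := repP i.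
    by rewrite !in_setX in_setT andbT inE rr -(isolated_twin ir).
  move=> i j; rewrite !in_setD => /andP[_ ik] /andP[_ jk] [] er ec.
  have {}ec : crank i = crank j by apply: inord_inj ec; apply: kt.
  apply: crank_inj ec; have /andP[_ ir] := repP i; have /andP[_ jr] := repP j.
  by apply: twin_trans ir _; rewrite er twin_sym.
apply: leq_trans (leq_add isoP mixP) _.
apply: leq_trans (_ : width.+1 * (k.*2.+1 * width) + 4 * k * width <= _).
  by rewrite leq_add2l leq_mul2r mk orbT.
(* The sum is $32k^3+56k^2+20k+2$, so the constant 200 is generous. *)
rewrite /width; case: k => [|m] //; nia.
Qed.

End Kernel.

(** * Compiling bounded-sum expressions *)

(** The base [N.+1] is positive, so raising the exponent never lowers the bound, even at [N = 0]. *)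
Definition poly_bounded (f : nat -> nat) : Prop :=
  exists c d, forall N, f N <= c * N.+1 ^ d.

Lemma poly_bounded_const c : poly_bounded (fun=> c).
Proof. by exists c, 0 => N; rewrite muln1. Qed.

Lemma poly_bounded_id : poly_bounded id.
Proof. by exists 1, 1 => N; rewrite mul1n expn1 leqnSn. Qed.

Lemma poly_boundedD f g :
  poly_bounded f -> poly_bounded g -> poly_bounded (fun N => f N + g N).
Proof.
move=> [c [d hf]] [c' [d' hg]]; exists (c + c'), (d + d') => N.
have h1 : N.+1 ^ d <= N.+1 ^ (d + d') by rewrite leq_pexp2l // leq_addr.
have h2 : N.+1 ^ d' <= N.+1 ^ (d + d') by rewrite leq_pexp2l // leq_addl.
rewrite mulnDl; apply: leq_add.
  by apply: leq_trans (hf N) _; rewrite leq_mul2l h1 orbT.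
by apply: leq_trans (hg N) _; rewrite leq_mul2l h2 orbT.
Qed.

Lemma poly_boundedM f g :
  poly_bounded f -> poly_bounded g -> poly_bounded (fun N => f N * g N).
Proof.
move=> [c [d hf]] [c' [d' hg]]; exists (c * c'), (d + d') => N.
by rewrite expnD mulnACA leq_mul.
Qed.

(** Variables are de Bruijn indices, and [Sum] binds one that ranges over the numbers below register
    0. It is the only loop, which keeps evaluation polynomial. *)
Inductive expr : Type :=
| Var (i : nat)
| Glob (r : nat)
| Cst (c : nat)
| AddE (e1 e2 : expr)
| SubE (e1 e2 : expr)
| Rd (e : expr)
| Ite (c e1 e2 : expr)
| Sum (e : expr).

(** Registers below this hold the parameters and the stored results; those from it on are scratch
    space. *)
Definition nglob := 10.

Fixpoint eval (g m : nat -> nat) (vs : seq nat) (e : expr) : nat :=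
  match e with
  | Var i => nth 0 vs i
  | Glob r => if r < nglob then g r else 0
  | Cst c => c
  | AddE e1 e2 => eval g m vs e1 + eval g m vs e2
  | SubE e1 e2 => eval g m vs e1 - eval g m vs e2
  | Rd e => m (eval g m vs e)
  | Ite c e1 e2 => if eval g m vs c != 0 then eval g m vs e1 else eval g m vs e2
  | Sum e => \sum_(j < g 0) eval g m (nat_of_ord j :: vs) e
  end.

Definition copy (d r : nat) : cmd := Seq (Const d 0) (Add d d r).

Definition decr (r tmp : nat) : cmd := Seq (Const tmp 1) (Defs.Sub r r tmp).

(** [Gam] lists the registers of the bound variables, and the result goes to [d], the first free
    register. For [Sum], [d] accumulates while [d.+1] counts down and, once decremented, serves as
    the bound variable. *)
Fixpoint compile (Gam : seq nat) (d : nat) (e : expr) : cmd :=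
  match e with
  | Var i => if i < size Gam then copy d (nth 0 Gam i) else Const d 0
  | Glob r => if r < nglob then copy d r else Const d 0
  | Cst c => Const d c
  | AddE e1 e2 => Seq (compile Gam d e1) (Seq (compile Gam d.+1 e2) (Add d d d.+1))
  | SubE e1 e2 => Seq (compile Gam d e1) (Seq (compile Gam d.+1 e2) (Defs.Sub d d d.+1))
  | Rd e => Seq (compile Gam d e) (Read d d)
  | Ite c e1 e2 => Seq (compile Gam d c) (If d (compile Gam d e1) (compile Gam d e2))
  | Sum e =>
    Seq (Const d 0) (Seq (copy d.+1 0)
      (While d.+1 (Seq (decr d.+1 d.+2)
                       (Seq (compile (d.+1 :: Gam) d.+2 e) (Add d d d.+2)))))
  end.

Fixpoint time (e : expr) (N : nat) : nat :=
  match e with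
  | Var _ | Glob _ => 2
  | Cst _ => 1
  | AddE e1 e2 | SubE e1 e2 => time e1 N + (time e2 N + 1)
  | Rd e => time e N + 1
  | Ite c e1 e2 => time c N + (time e1 N + time e2 N + 1)
  | Sum e => 3 + (N * (time e N + 4) + 1)
  end.

Lemma poly_bounded_time e : poly_bounded (time e).
Proof.
elim: e => /= [i|r|c|e1 h1 e2 h2|e1 h1 e2 h2|e h|c h e1 h1 e2 h2|e h].
- exact: poly_bounded_const.
- exact: poly_bounded_const.
- exact: poly_bounded_const.
- by do 2!apply: poly_boundedD => //; apply: poly_bounded_const.
- by do 2!apply: poly_boundedD => //; apply: poly_bounded_const.
- by apply: poly_boundedD => //; apply: poly_bounded_const.
- apply: poly_boundedD => //; apply: poly_boundedD; last exact: poly_bounded_const.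
  exact: poly_boundedD.
- apply: poly_boundedD; first exact: poly_bounded_const.
  apply: poly_boundedD; last exact: poly_bounded_const.
  apply: poly_boundedM; first exact: poly_bounded_id.
  by apply: poly_boundedD => //; apply: poly_bounded_const.
Qed.

(** * Total-correctness Hoare rules with time bounds *)

Definition runs (c : cmd) (s : state) (T : nat) (Q : state -> Prop) : Prop :=
  exists t s', [/\ exec c s t s', t <= T & Q s'].

Lemma runs_exec c s t s' (Q : state -> Prop) : exec c s t s' -> Q s' -> runs c s t Q.
Proof. by exists t, s'. Qed.

Lemma runs_seq c1 c2 s T1 T2 (Q1 Q2 : state -> Prop) :
  runs c1 s T1 Q1 -> (forall s', Q1 s' -> runs c2 s' T2 Q2) ->
  runs (Seq c1 c2) s (T1 + T2) Q2.
Proof.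
move=> [t [s1 [x1 l1 q1]]] /(_ _ q1) [u [s2 [x2 l2 q2]]].
by exists (t + u), s2; split; [exact: exec_seq x1 x2 | exact: leq_add |].
Qed.

Lemma runs_if r c1 c2 s T1 T2 (Q : state -> Prop) :
  (regs s r != 0 -> runs c1 s T1 Q) -> (regs s r = 0 -> runs c2 s T2 Q) ->
  runs (If r c1 c2) s (T1 + T2 + 1) Q.
Proof.
move=> h1 h2; case: (eqVneq (regs s r) 0) => h.
  case: (h2 h) => t [s' [x l q]]; exists t.+1, s'; split=> //; last lia.
  exact: exec_if_false.
case: (h1 h) => t [s' [x l q]]; exists t.+1, s'; split=> //; last lia.
exact: exec_if_true.
Qed.

Lemma runs_weaken c s T T' (Q Q' : state -> Prop) :
  T <= T' -> (forall s', Q s' -> Q' s') -> runs c s T Q -> runs c s T' Q'.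
Proof.
move=> lT QQ [t [s' [x l q]]]; exists t, s'; split=> //; last exact: QQ.
exact: leq_trans lT.
Qed.

(** For loops that count down: the invariant is indexed by the loop register, which thus gives the
    number of remaining rounds. *)
Lemma runs_while r c T (Inv : nat -> state -> Prop) :
  (forall j s, Inv j s -> regs s r = j) ->
  (forall j s, Inv j.+1 s -> runs c s T (Inv j)) ->
  forall j s, Inv j s -> runs (While r c) s (j * T.+1 + 1) (Inv 0).
Proof.
move=> Ir Ic; elim=> [|j IH] s Is.
  by exists 1, s; split=> //; apply: exec_while_stop; apply: Ir.
have [t [s1 [x1 l1 /IH[u [s2 [x2 l2 q2]]]]]] := Ic _ _ Is.
exists (t + u).+1, s2; split=> //; last by rewrite mulSn; lia.
by apply: exec_while_loop x1 x2; rewrite (Ir _ _ Is).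
Qed.

Lemma upd_eq f x v : upd f x v x = v. Proof. by rewrite /upd eqxx. Qed.

Lemma upd_neq f x v y : y != x -> upd f x v y = f y.
Proof. by rewrite /upd => /negbTE ->. Qed.

(* Code for an expression may clobber the registers from [d] on, nothing else. *)
Definition yields (d v : nat) (s s' : state) : Prop :=
  [/\ regs s' d = v, memory s' = memory s &
      forall r, r < d -> regs s' r = regs s r].

Lemma runs_copy d r s : r < d -> runs (copy d r) s 2 (yields d (regs s r) s).
Proof.
move=> rd; apply: runs_exec (exec_seq (exec_const _ _ _) (exec_add _ _ _ _)) _.
split=> //= [|x xd]; first by rewrite !upd_eq upd_neq // neq_ltn rd.
by rewrite !upd_neq // neq_ltn xd.
Qed.

Lemma runs_const d c s : runs (Const d c) s 1 (yields d c s).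
Proof.
apply: runs_exec (exec_const _ _ _) _.
split=> //= [|x xd]; first by rewrite upd_eq.
by rewrite upd_neq // neq_ltn xd.
Qed.

Definition env_ok (g : nat -> nat) (Gam vs : seq nat) (d : nat) (s : state) : Prop :=
  [/\ nglob <= d, forall r, r < nglob -> regs s r = g r, size Gam = size vs &
      forall i, i < size Gam -> nth 0 Gam i < d /\ regs s (nth 0 Gam i) = nth 0 vs i].

Lemma env_ok_step g Gam vs d d' s s' : d <= d' ->
  (forall r, r < d -> regs s' r = regs s r) ->
  env_ok g Gam vs d s -> env_ok g Gam vs d' s'.
Proof.
move=> dd e [h1 h2 h3 h4]; split=> //; first exact: leq_trans dd.
  by move=> r rn; rewrite e ?h2 //; apply: leq_trans rn h1.
move=> i iG; have [h5 h6] := h4 i iG; split; first exact: leq_trans dd.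
by rewrite e.
Qed.

Lemma env_ok_cons g Gam vs d s x j : x < d -> regs s x = j ->
  env_ok g Gam vs d s -> env_ok g (x :: Gam) (j :: vs) d s.
Proof.
move=> xd sx [h1 h2 h3 h4]; split=> //=; first by rewrite h3.
by case=> [|i] //= /h4.
Qed.

Lemma runs_compile e : forall g Gam vs d s, env_ok g Gam vs d s ->
  runs (compile Gam d e) s (time e (g 0)) (yields d (eval g (memory s) vs e) s).
Proof.
(* Addition and subtraction are compiled alike and are treated together. *)
have binop (op : nat -> nat -> nat) (I : nat -> nat -> nat -> cmd) :
    (forall s r x y, exec (I r x y) s 1 (set_reg s r (op (regs s x) (regs s y)))) ->
    forall e1 e2,
    (forall g Gam vs d s, env_ok g Gam vs d s ->
      runs (compile Gam d e1) s (time e1 (g 0)) (yields d (eval g (memory s) vs e1) s)) ->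
    (forall g Gam vs d s, env_ok g Gam vs d s ->
      runs (compile Gam d e2) s (time e2 (g 0)) (yields d (eval g (memory s) vs e2) s)) ->
    forall g Gam vs d s, env_ok g Gam vs d s ->
    runs (Seq (compile Gam d e1) (Seq (compile Gam d.+1 e2) (I d d d.+1))) s
      (time e1 (g 0) + (time e2 (g 0) + 1))
      (yields d (op (eval g (memory s) vs e1) (eval g (memory s) vs e2)) s).
  move=> Iop e1 e2 IH1 IH2 g Gam vs d s ok.
  apply: runs_seq (IH1 _ _ _ _ _ ok) _ => s1 [r1 m1 p1].
  have ok1 := env_ok_step (leqnSn d) p1 ok.
  apply: runs_seq (IH2 _ _ _ _ _ ok1) _ => s2 [r2 m2 p2].
  apply: runs_exec (Iop _ _ _ _) _; split=> /= [||r rd]; first by rewrite upd_eq p2 // r1 r2 m1.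
    by rewrite m2 m1.
  by rewrite upd_neq ?p2 ?p1 // ?neq_ltn ?rd // ltnW.
elim: e => /= [i|r|c|e1 IH1 e2 IH2|e1 IH1 e2 IH2|e IH|c IHc e1 IH1 e2 IH2|e IH] g Gam vs d s ok.
- case: ifP => iG; last first.
    rewrite nth_default; first by apply: runs_weaken (runs_const _ _ _).
    by case: ok => _ _ <- _; rewrite leqNgt iG.
  by case: ok => _ _ _ /(_ i iG)[h <-]; apply: runs_copy.
- case: ifP => rG; last by apply: runs_weaken (runs_const _ _ _).
  by case: ok => h /(_ r rG) <- _ _; apply: runs_copy; apply: leq_trans h.
- exact: runs_const.
- exact: (binop addn Add exec_add).
- exact: (binop subn Defs.Sub exec_sub).
- apply: runs_seq (IH _ _ _ _ _ ok) _ => s1 [r1 m1 p1].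
  apply: runs_exec (exec_read _ _ _) _; split=> /= [||r rd]; first by rewrite upd_eq r1 m1.
    by rewrite m1.
  by rewrite upd_neq ?p1 // neq_ltn rd.
- apply: runs_seq (IHc _ _ _ _ _ ok) _ => s1 [r1 m1 p1].
  have ok1 := env_ok_step (leqnn d) p1 ok.
  have step v s2 : yields d v s1 s2 -> yields d v s s2.
    by case=> r2 m2 p2; split=> [||r rd]; rewrite ?r2 ?m2 // p2 ?p1.
  rewrite -m1; apply: runs_if; rewrite r1 -m1 => h; rewrite h /=.
    by apply: runs_weaken (step _) (IH1 _ _ _ _ _ ok1).
  by apply: runs_weaken (step _) (IH2 _ _ _ _ _ ok1).
- rewrite -[3 + _]/(1 + (2 + _)).
  apply: runs_seq (runs_const _ _ _) _ => s1 [r1 m1 p1].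
  apply: runs_seq.
    exact: (@runs_copy d.+1 0).
  move=> s2 [r2 m2 p2].
  pose F j := eval g (memory s) (j :: vs) e.
  (* The loop counts down, so the terms still missing from register [d] are those with index below
     [j]. *)
  pose Inv j s' := [/\ regs s' d.+1 = j, memory s' = memory s,
    forall r, r < d -> regs s' r = regs s r &
    regs s' d + \sum_(i < j) F i = \sum_(i < g 0) F i].
  have I0 : Inv (g 0) s2.
    case: (ok) => hd hg _ _; split; rewrite ?m2 ?m1 //.
    - by rewrite r2 p1 ?hg //; apply: leq_trans hd.
    - by move=> r rd; rewrite p2 ?p1 // ltnW.
    - by rewrite p2 // r1.
  have -> : g 0 * (time e (g 0) + 4) + 1 = g 0 * (time e (g 0) + 3).+1 + 1 by rewrite -addnS.
  apply: runs_weaken (@runs_while d.+1 _ (time e (g 0) + 3) Inv _ _ (g 0) s2 I0) => //.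
  + by move=> s3 [h1 h2 h3 h4]; split=> //; rewrite -h4 big_ord0 addn0.
  + by move=> j s3 [].
  move=> j s3 [h1 h2 h3 h4].
  have -> : time e (g 0) + 3 = 2 + (time e (g 0) + 1) by lia.
  apply: (@runs_seq _ _ _ _ _ (fun s4 => [/\ regs s4 d.+1 = j, memory s4 = memory s &
      forall r, r < d.+1 -> regs s4 r = regs s3 r])).
    apply: runs_exec (exec_seq (exec_const _ _ _) (exec_sub _ _ _ _)) _.
    split=> //= [|r rd].
      by rewrite !upd_eq upd_neq ?h1 ?subn1 //; lia.
    by rewrite !upd_neq //; lia.
  move=> s4 [k1 k2 k3].
  have ok4 : env_ok g (d.+1 :: Gam) (j :: vs) d.+2 s4.
    apply: env_ok_cons => //; apply: env_ok_step ok; first lia.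
    by move=> r rd; rewrite k3 ?h3 //; lia.
  apply: runs_seq (IH _ _ _ _ _ ok4) _ => s5 [r5 m5 p5].
  apply: runs_exec (exec_add _ _ _ _) _; split=> /=.
  + by rewrite upd_neq ?p5 //; lia.
  + by rewrite m5 k2.
  + by move=> r rd; rewrite upd_neq ?p5 ?k3 ?h3 //; lia.
  + have [p5d k3d] : regs s5 d = regs s4 d /\ regs s4 d = regs s3 d by split; [apply: p5; lia | exact: k3].
    by rewrite upd_eq r5 p5d k3d k2 -h4 big_ord_recr /= [RHS]addnCA addnC addnA -/(F j) addnC.
Qed.

(** * Assigning registers and filling matrices *)

Definition agree (g m : nat -> nat) (s : state) : Prop :=
  (forall r, r < nglob -> regs s r = g r) /\ memory s = m.

Definition assign (r : nat) (e : expr) : cmd :=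
  Seq (compile [::] nglob e) (Seq (Const r 0) (Add r r nglob)).

Lemma runs_assign r e g m s : r < nglob -> agree g m s ->
  runs (assign r e) s (time e (g 0) + 2) (agree (upd g r (eval g m [::] e)) m).
Proof.
move=> rn [sg sm].
have ok : env_ok g [::] [::] nglob s by split.
apply: runs_seq (runs_compile e ok) _ => s1 [r1 m1 p1].
apply: runs_exec (exec_seq (exec_const _ _ _) (exec_add _ _ _ _)) _.
split=> [x xn|]; last by rewrite /= m1.
have nr : nglob != r by lia.
rewrite /= /upd eqxx (negbTE nr); case: (x == r); first by rewrite r1 sm.
by rewrite p1 ?sg.
Qed.

(** Register 10 holds the row and 11 the column; in [ea] and [ev] the column has index 0 and the row
    index 1. *)
Definition fill_body (ea ev : expr) : cmd :=
  Seq (decr 11 12) (Seq (compile [:: 11; 10] 12 ea)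
    (Seq (compile [:: 11; 10] 13 ev) (Write 12 13))).

Definition fill (ea ev : expr) : cmd :=
  Seq (copy 10 0) (While 10
    (Seq (decr 10 11) (Seq (copy 11 0) (While 11 (fill_body ea ev))))).

Definition time_fill (ea ev : expr) (N : nat) : nat :=
  2 + (N * (2 + (2 + (N * (2 + (time ea N + (time ev N + 1))).+1 + 1))).+1 + 1).

Lemma poly_bounded_fill ea ev : poly_bounded (time_fill ea ev).
Proof.
have succ f : poly_bounded f -> poly_bounded (fun N => (f N).+1).
  move=> h; case: (poly_boundedD h (poly_bounded_const 1)) => c [d hc].
  by exists c, d => N; rewrite -addn1.
have T := poly_bounded_time.
rewrite /time_fill.
repeat first [exact: T | exact: poly_bounded_const | exact: poly_bounded_id
  | apply: poly_boundedD | apply: poly_boundedM | apply: (succ)].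
Qed.

Lemma runs_decr x d (j : nat) s : x < d -> regs s x = j.+1 ->
  runs (decr x d) s 2 (fun s' => [/\ regs s' x = j, memory s' = memory s &
    forall r, r < d -> r != x -> regs s' r = regs s r]).
Proof.
move=> xd sx; apply: runs_exec (exec_seq (exec_const _ _ _) (exec_sub _ _ _ _)) _.
split=> //= [|r rd rx].
  by rewrite !upd_eq upd_neq ?sx ?subn1 //; lia.
by rewrite !upd_neq //; lia.
Qed.

Section Fill.
Variables (g m : nat -> nat) (P : pred nat) (A V : nat -> nat -> nat) (ea ev : expr).
Let n := g 0.
Hypothesis evalA : forall m' x y, (forall p, P p -> m' p = m p) -> x < n -> y < n ->
  eval g m' [:: y; x] ea = A x y.
Hypothesis evalV : forall m' x y, (forall p, P p -> m' p = m p) -> x < n -> y < n ->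
  eval g m' [:: y; x] ev = V x y.
Hypothesis AP : forall x y, x < n -> y < n -> ~~ P (A x y).

(** [P] marks the protected cells: agreement with [m] there is enough to evaluate [ea] and [ev]
    correctly, and no write hits them. [D] marks the positions already processed. A value is
    promised only for an address with a single source, since positions may share a dummy address. *)
Definition stored (D : nat -> nat -> bool) (m' : nat -> nat) : Prop :=
  (forall p, P p -> m' p = m p) /\
  (forall x y, x < n -> y < n -> D x y ->
    (forall x' y', x' < n -> y' < n -> A x' y' = A x y -> x' = x /\ y' = y) ->
    m' (A x y) = V x y).

Let globals s := forall r, r < nglob -> regs s r = g r.

Let inner x j s := [/\ regs s 11 = j, regs s 10 = x, globals s, j <= n &
  stored (fun x' y' => (x < x') || ((x' == x) && (j <= y'))) (memory s)].

Let outer j s := [/\ regs s 10 = j, globals s, j <= n &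
  stored (fun x' y' => j <= x') (memory s)].

Lemma runs_fill_body x j s : x < n -> inner x j.+1 s ->
  runs (fill_body ea ev) s (2 + (time ea n + (time ev n + 1))) (inner x j).
Proof.
move=> xn [h1 h2 h3 h4 [h5 h6]].
apply: (runs_seq (runs_decr (d := 12) _ h1)) => // s1 [k1 k2 k3].
have k3' r : r < 11 -> regs s1 r = regs s r by move=> rd; apply: k3; lia.
have ok1 : env_ok g [:: 11; 10] [:: j; x] 12 s1.
  split=> // [r rn|]; first by rewrite k3' ?h3 //; apply: leq_trans rn _.
  by case=> [|[|]] //= _; rewrite k3' ?h2.
apply: runs_seq (runs_compile ea ok1) _ => s2 [r2 m2 p2].
have ok2 := env_ok_step (leqnSn 12) p2 ok1.
apply: runs_seq (runs_compile ev ok2) _ => s3 [r3 m3 p3].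
apply: runs_exec (exec_write _ _ _) _.
have mP p : P p -> memory s1 p = m p by rewrite k2; apply: h5.
have a12 : regs s3 12 = A x j by rewrite p3 // r2 evalA.
have a13 : regs s3 13 = V x j by rewrite r3 m2 evalV.
have low r : r < 12 -> regs s3 r = regs s1 r by move=> rl; rewrite p3 ?p2 // ltnW.
split=> /=.
- by rewrite low.
- by rewrite low // k3'.
- move=> r rn; have rn' : r < 11 := leq_trans rn (leqnSn _).
  by rewrite /= low ?k3' ?h3 // ltnW.
- exact: ltnW.
rewrite a12 a13 m3 m2 k2; split=> [p Pp|x' y' x'n y'n D uniq].
  by rewrite upd_neq ?h5 //; apply/eqP => e; have := AP xn h4; rewrite -e Pp.
(* If the write hits the address of [(x', y')], uniqueness makes it the same position; otherwise the
   earlier content survives. *)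
case: (eqVneq (A x j) (A x' y')) => e.
  by have [<- <-] := uniq _ _ xn h4 e; rewrite upd_eq.
rewrite upd_neq 1?eq_sym // h6 //; case/orP: D => [->//|/andP[/eqP ex jy]].
have -> : j < y' by rewrite ltn_neqAle jy andbT; apply: contra e => /eqP ->; rewrite ex.
by rewrite ex eqxx orbT.
Qed.

Lemma runs_fill s : agree g m s -> runs (fill ea ev) s (time_fill ea ev n)
  (fun s' => exists2 m', agree g m' s' & stored (fun _ _ => true) m').
Proof.
move=> [sg sm]; apply: runs_seq (@runs_copy 10 0 s isT) _ => s1 [r1 m1 p1].
have I0 : outer n s1.
  split=> //; first by rewrite r1 sg.
    by move=> r rn; rewrite p1 ?sg.
  by rewrite m1 sm; split=> // x y xn _; rewrite leqNgt xn.
apply: runs_weaken (@runs_while 10 _ (2 + (2 + (n * (2 + (time ea n + (time ev n + 1))).+1 + 1)))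
  outer _ _ n s1 I0) => //.
- move=> s2 [h1 h2 h3 h4]; exists (memory s2); first by split.
  by case: h4 => h4 h5; split=> // x y xn yn _ u; apply: h5.
- by move=> j s2 [].
move=> j s2 [h1 h2 h3 h4].
apply: (runs_seq (runs_decr (d := 11) _ h1)) => // s3 [k1 k2 k3].
have gs3 : globals s3 by move=> r rn; rewrite k3 ?h2 //; move: rn; rewrite /nglob; lia.
apply: runs_seq (@runs_copy 11 0 s3 isT) _ => s4 [r4 m4 p4].
have I1 : inner j n s4.
  split=> //; first by rewrite r4 gs3.
  - by rewrite p4.
  - by move=> r rn; rewrite p4 ?gs3 //; apply: leq_trans rn _.
  rewrite m4 k2; case: h4 => h4 h5; split=> // x y xn yn D u; apply: h5 => //.
  by case/orP: D => // /andP[_]; rewrite leqNgt yn.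
apply: runs_weaken (@runs_while 11 _ _ (inner j) _ _ n s4 I1) => //.
- move=> s5 [q1 q2 q3 q4 [q5 q6]]; split=> //; first exact: ltnW.
  split=> // x y xn yn D u; apply: q6 => //.
  by move: D; rewrite leq_eqVlt eq_sym => /orP[/eqP ->|->//]; rewrite eqxx orbT.
- by move=> i s5 [].
by move=> i s5; apply: runs_fill_body.
Qed.

End Fill.

(** * The kernel and its computation *)

Definition edges_of (V : finType) (r : rel V) : {set {set V}} :=
  [set e in pairs V | [exists x, exists y, (e == [set x; y]) && r x y]].

Lemma edges_of_pairs (V : finType) (r : rel V) : edges_of r \subset pairs V.
Proof. by apply/subsetP => e; rewrite inE => /andP[]. Qed.

Definition graph_of (V : finType) (r : rel V) : graph V := Graph (edges_of_pairs r).

Lemma adj_graph_of (V : finType) (r : rel V) x y : symmetric r ->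
  adj (graph_of r) x y = (x != y) && r x y.
Proof.
move=> sr; rewrite /adj /graph_of /= !inE cards2 eqSS eqb1; case: (x != y) => //=.
apply/existsP/idP => [[u /existsP[v /andP[/eqP /set2_inj]]]|rxy].
  by rewrite !inE !xpair_eqE => /orP[] /andP[/eqP -> /eqP ->] //; rewrite sr.
by exists x; apply/existsP; exists y; rewrite eqxx.
Qed.

(** A single edge and an isolated vertex: a cluster graph with components of sizes 2 and 1, hence
    unbalanced for imbalance 0 and not repairable with budget 0. *)
Definition no_adj : rel 'I_3 := fun x y => x + y == 1.

Definition no_instance : instance := @Instance 3 (graph_of no_adj) 0 0.

Lemma no_adj_sym : symmetric no_adj.
Proof. by move=> x y; rewrite /no_adj addnC. Qed.

Lemma adj_no_instance x y : adj (igraph no_instance) x y = (x + y == 1).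
Proof.
rewrite (adj_graph_of _ _ no_adj_sym) /no_adj; case: eqP => //= ->.
by rewrite addnn; case: (nat_of_ord y).
Qed.

Lemma no_instanceP : ~ yes_instance no_instance.
Proof.
move/yes_instanceE => [l [lk lb]].
have lE x y : (l x == l y) = nbr (igraph no_instance) x y.
  apply: (untouched_label (S := setT)); rewrite ?inE //.
  apply/negP => /imsetP[p pM _].
  by move: lk; rewrite leqn0 cards_eq0 => /eqP e; rewrite e inE in pM.
pose o1 : 'I_3 := Ordinal (isT : 1 < 3).
have := lb ord0 ord_max (in_setT _) (in_setT _); rewrite addn0 leqNgt => /negP; apply.
apply: leq_ltn_trans (_ : #|[set ord_max : 'I_3]| < _).
  apply: subset_leq_card; apply/subsetP => z; rewrite !inE lE /nbr adj_no_instance.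
  by case: z => [[|[|[|]]]].
rewrite cards1; apply: leq_trans (_ : #|[set (ord0 : 'I_3); o1]| <= _); first by rewrite cards2.
apply: subset_leq_card.
by apply/subsetP => z; rewrite !inE lE /nbr adj_no_instance => /orP[] /eqP ->.
Qed.

(** * The kernel instance and its equivalence with the input *)

Section KernelInstance.
Variable I : instance.
Notation n := (nverts I).
Notation k := (budget I).
Notation eta := (imbalance I).
Notation G := (igraph I).
Notation a := (nbr G).

(** These conditions are necessary for a yes-instance, by [card_mixed_reps] and the two trimming
    equivalences, so rejection is sound. *)
Definition accepted : bool :=
  (#|mixed_reps a| <= 4 * k) &&
  (if [exists i, i \in rest a k] then shrink a k <= eta
   else [forall i, (i \in large a k) ==>
          [forall j, (j \in large a k) ==>
             (deg a [set: 'I_n] i <= deg a [set: 'I_n] j + eta)]]).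

Definition kernel_imbalance : nat :=
  if [exists i, i \in rest a k] then eta - shrink a k else n.

(** Defined on natural numbers because the program evaluates it at all positions of an [n] by [n]
    matrix, of which only a corner is output. *)
Definition kernel_rel (x y : nat) : bool :=
  [exists i, exists j, [&& i \in kept a k, j \in kept a k,
     rank (kept a k) i == x, rank (kept a k) j == y & adj G i j]].

Definition kernel_adj : rel 'I_#|kept a k| := fun x y => kernel_rel x y.

Definition kernel_instance : instance :=
  @Instance _ (graph_of kernel_adj) k kernel_imbalance.

Lemma kernel_adj_sym : symmetric kernel_adj.
Proof.
suff h x y : kernel_adj x y -> kernel_adj y x by move=> x y; apply/idP/idP; apply: h.
case/existsP=> i /existsP[j /and5P[ik jk ix jy ij]].
by apply/existsP; exists j; apply/existsP; exists i; rewrite ik jk ix jy adj_sym.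
Qed.

Lemma adj_kernel x y : adj (graph_of kernel_adj) x y = kernel_adj x y.
Proof.
rewrite (adj_graph_of _ _ kernel_adj_sym); case: eqP => //= ->; apply/esym/negbTE/negP.
move=> /existsP[i /existsP[j /and5P[ik jk /eqP iy /eqP jy]]].
suff -> : i = j by rewrite adj_irr.
by apply: (rank_inj ik jk); rewrite /= iy jy.
Qed.

(** Transport along the inverse of [rank] on the kept vertices. *)
Lemma editable_kernel e :
  editable (nbr (graph_of kernel_adj)) [set: 'I_#|kept a k|] k e <->
  editable a (kept a k) k e.
Proof.
have h (x : 'I_#|kept a k|) : exists i, (i \in kept a k) && (rank (kept a k) i == x).
  by have [i ik <-] := rank_surj (ltn_ord x); exists i; rewrite ik eqxx.
pose phi x := xchoose (h x).
have phiP x : phi x \in kept a k /\ rank (kept a k) (phi x) = x.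
  by case/andP: (xchooseP (h x)) => ? /eqP.
have phi_inj : injective phi.
  by move=> x y e'; apply/val_inj; rewrite /= -(phiP x).2 e' (phiP y).2.
apply: (@editable_transport _ _ _ _ _ _ phi) => [x y _ _|| x y _ _]; first exact: phi_inj.
  apply/eqP; rewrite eqEcard card_imset // cardsT card_ord leqnn andbT.
  by apply/subsetP => _ /imsetP[x _ ->]; exact: (phiP x).1.
rewrite /nbr (inj_eq phi_inj) adj_kernel; congr (_ || _); apply/idP/existsP => [h'|].
  exists (phi x); apply/existsP; exists (phi y).
  by rewrite (phiP x).1 (phiP y).1 (phiP x).2 (phiP y).2 !eqxx.
case=> i /existsP[j /and5P[ik jk /eqP ix /eqP jy ij]].
have -> : phi x = i by apply: (rank_inj (phiP x).1 ik); rewrite /= (phiP x).2 ix.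
suff -> : phi y = j by [].
by apply: (rank_inj (phiP y).1 jk); rewrite /= (phiP y).2 jy.
Qed.

Definition kernel : instance := if accepted then kernel_instance else no_instance.

Lemma exists_rest : [exists i, i \in rest a k] = (rest a k != set0).
Proof. by apply/existsP/set0Pn. Qed.

Lemma kernel_correct : yes_instance kernel <-> yes_instance I.
Proof.
have ar := @nbr_refl _ G; have asy := @nbr_sym _ G.
rewrite /kernel; case: ifP => acc; last first.
  split=> [/no_instanceP//|/yes_instanceE yI].
  move: acc; rewrite /accepted (card_mixed_reps yI) exists_rest /=.
  case: eqP => R0.
    move/(editable_trim_large ar asy _ R0): yI => [h _] /= /negP[].
    apply/forallP => i; apply/implyP => iL; apply/forallP => j; apply/implyP => jL.
    exact: h.
  by move/eqP: R0 => /(editable_trim_rest ar asy _) h; move/h: yI => [-> _].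
move: acc => /andP[_]; rewrite exists_rest => acc.
split=> [/yes_instanceE /= yK|yI]; [apply/yes_instanceE | apply/yes_instanceE => /=].
  move/editable_kernel/(editable_kept _ ar asy): yK; rewrite /kernel_imbalance exists_rest.
  case: eqP acc => [R0|/eqP R0] /= acc yK; last by apply/(editable_trim_rest ar asy _ R0).
  apply/(editable_trim_large ar asy _ R0); split=> // i j iL jL.
  by move/forallP/(_ i)/implyP/(_ iL)/forallP/(_ j)/implyP: acc; apply.
apply/editable_kernel/(editable_kept _ ar asy); rewrite /kernel_imbalance exists_rest.
move/yes_instanceE: yI; case: eqP => [R0|/eqP R0] /=.
  by move/(editable_trim_large ar asy _ R0) => [].
by move/(editable_trim_rest ar asy _ R0) => [].
Qed.

Lemma nverts_kernel : nverts kernel <= 200 * (k ^ 3 + 1).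
Proof.
rewrite /kernel; case: ifP => [/andP[h _]|_]; last by rewrite /=; lia.
by have := card_kept h.
Qed.

(** This compares the output with the encoded input, whose length is only logarithmic in [k]; the 3
    accounts for [no_instance]. *)
Lemma nverts_kernel_le : nverts kernel <= maxn n 3.
Proof.
rewrite /kernel leq_max; case: ifP => _ //=; last by rewrite orbT.
by rewrite -[X in _ <= X]card_ord max_card.
Qed.

Lemma budget_kernel : budget kernel <= k.
Proof. by rewrite /kernel; case: ifP. Qed.

Lemma imbalance_kernel : imbalance kernel <= maxn eta n.
Proof.
rewrite /kernel; case: ifP => _ //=; rewrite /kernel_imbalance; case: ifP => _; lia.
Qed.

End KernelInstance.

Definition notE e := SubE (Cst 1) e.
Definition andE e1 e2 := Ite e1 e2 (Cst 0).
Definition impE e1 e2 := Ite e1 e2 (Cst 1).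
(** Truth values are 0 and 1; by truncation, [1 - (x - y)] is 1 exactly when [x <= y]. *)
Definition leE e1 e2 := notE (SubE e1 e2).
Definition ltE e1 e2 := leE (AddE e1 (Cst 1)) e2.
Definition equalE e1 e2 := andE (leE e1 e2) (leE e2 e1).
Definition exE e := ltE (Cst 0) (Sum e).
Definition allE e := notE (exE (notE e)).
Definition minE e1 e2 := Ite (leE e1 e2) e1 e2.

(* An argument [i] of the expressions below is a de Bruijn index; each [Sum]  *)
(* and each quantifier shifts the indices of its scope by one.                *)
Definition timesE i := Sum (Var i.+1).
Definition adjE i j := Rd (AddE (timesE i) (Var j)).
Definition nbrE i j := Ite (equalE (Var i) (Var j)) (Cst 1) (adjE i j).
Definition twinE i j := allE (equalE (nbrE i.+1 0) (nbrE j.+1 0)).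
Definition classE i := Sum (twinE i.+1 0).
Definition crankE i := Sum (andE (twinE i.+1 0) (ltE (Var 0) (Var i.+1))).
Definition k2E := AddE (Glob 1) (Glob 1).
Definition k4E := AddE k2E k2E.
Definition widthE := AddE k4E (Cst 1).
Definition largeE i := ltE k2E (classE i).
Definition in_restE i := allE (impE (largeE 0) (notE (nbrE i.+1 0))).
Definition has_restE := exE (in_restE 0).
Definition trimmedE i := ltE (crankE i) widthE.
Definition csizeE i := minE (classE i) widthE.
Definition degE i := Sum (nbrE i.+1 0).
Definition deg_trimmedE i := Sum (andE (trimmedE 0) (nbrE i.+1 0)).
(* The maximum of f is the number of j below some value of f. *)
Definition maxlargeE e := Sum (exE (andE (largeE 0) (ltE (Var 1) e))).
Definition shrinkE := SubE (maxlargeE (degE 0)) (maxlargeE (deg_trimmedE 0)).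
Definition isolatedE i := allE (impE (nbrE i.+1 0) (twinE i.+1 0)).
Definition is_repE i := equalE (crankE i) (Cst 0).
Definition clique_rankE i := Sum (andE
  (andE (is_repE 0) (andE (isolatedE 0) (equalE (csizeE 0) (csizeE i.+1))))
  (allE (impE (twinE i.+2 0) (ltE (Var 1) (Var 0))))).
Definition keptE i := andE (trimmedE i) (impE (isolatedE i) (leE (clique_rankE i) k2E)).
Definition mixedE := Sum (andE (is_repE 0) (notE (isolatedE 0))).
Definition acceptedE := andE (leE mixedE k4E)
  (Ite has_restE (leE shrinkE (Glob 2))
    (allE (impE (largeE 0)
      (allE (impE (largeE 0) (leE (degE 1) (AddE (degE 0) (Glob 2)))))))).
Definition kernel_imbalanceE := Ite has_restE (SubE (Glob 2) shrinkE) (Glob 0).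
Definition card_keptE := Sum (keptE 0).
Definition kept_rankE i := Sum (andE (keptE 0) (ltE (Var 0) (Var i.+1))).
Definition kernel_adjE := exE (exE
  (andE (keptE 1) (andE (keptE 0) (andE (equalE (kept_rankE 1) (Var 3))
    (andE (equalE (kept_rankE 0) (Var 2)) (adjE 1 0)))))).

(** * The expressions compute the intended quantities *)

Section Evaluation.
Variables (I : instance) (g m : nat -> nat).
Notation n := (nverts I).
Notation k := (budget I).
Notation eta := (imbalance I).
Notation G := (igraph I).
Notation a := (nbr G).
Hypotheses (g0 : g 0 = n) (g1 : g 1 = k) (g2 : g 2 = eta).
Hypothesis mG : forall i j : 'I_n, m (i * n + j) = adj G i j.
Notation ev := (eval g m).
Implicit Types (vs : seq nat) (b : bool).

Lemma ev_not vs e b : ev vs e = b -> ev vs (notE e) = ~~ b.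
Proof. by move=> /= ->; case: b. Qed.

Lemma ev_and vs e1 e2 b1 b2 : ev vs e1 = b1 -> ev vs e2 = b2 -> ev vs (andE e1 e2) = b1 && b2.
Proof. by move=> /= -> ->; case: b1. Qed.

Lemma ev_imp vs e1 e2 b1 b2 : ev vs e1 = b1 -> ev vs e2 = b2 -> ev vs (impE e1 e2) = (b1 ==> b2).
Proof. by move=> /= -> ->; case: b1. Qed.

Lemma ev_le vs e1 e2 x y : ev vs e1 = x -> ev vs e2 = y -> ev vs (leE e1 e2) = (x <= y).
Proof. by move=> /= -> ->; lia. Qed.

Lemma ev_lt vs e1 e2 x y : ev vs e1 = x -> ev vs e2 = y -> ev vs (ltE e1 e2) = (x < y).
Proof. by move=> /= -> ->; lia. Qed.

Lemma ev_eq vs e1 e2 x y : ev vs e1 = x -> ev vs e2 = y -> ev vs (equalE e1 e2) = (x == y).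
Proof. by move=> h1 h2; rewrite eqn_leq; apply: ev_and; apply: ev_le. Qed.

Lemma ev_min vs e1 e2 x y : ev vs e1 = x -> ev vs e2 = y -> ev vs (minE e1 e2) = minn x y.
Proof.
move=> h1 h2; rewrite /minE -[LHS]/(if ev vs (leE e1 e2) != 0 then ev vs e1 else ev vs e2).
by rewrite (ev_le h1 h2) h1 h2 eqb0 negbK /minn; case: ltngtP.
Qed.

Lemma ev_sum vs e F : (forall j : 'I_n, ev (nat_of_ord j :: vs) e = F j) ->
  ev vs (Sum e) = \sum_(j < n) F j.
Proof.
move=> h; rewrite /= -(big_mkord xpredT (fun j => ev (j :: vs) e)) g0 big_mkord.
by apply: eq_bigr => j _; apply: h.
Qed.

Lemma ev_count vs e (p : pred 'I_n) :
  (forall j : 'I_n, ev (nat_of_ord j :: vs) e = p j) -> ev vs (Sum e) = #|[set j | p j]|.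
Proof.
move=> h; rewrite (ev_sum h) -sum1_card [RHS]big_mkcond /=.
by apply: eq_bigr => j _; rewrite inE; case: (p j).
Qed.

Lemma ev_ex vs e (p : pred 'I_n) :
  (forall j : 'I_n, ev (nat_of_ord j :: vs) e = p j) -> ev vs (exE e) = [exists j, p j].
Proof.
move=> h; rewrite (ev_lt (x := 0) _ (ev_count h)) //; congr nat_of_bool.
by apply/card_gt0P/existsP => -[j]; rewrite ?inE => pj; exists j; rewrite ?inE.
Qed.

Lemma ev_all vs e (p : pred 'I_n) :
  (forall j : 'I_n, ev (nat_of_ord j :: vs) e = p j) -> ev vs (allE e) = [forall j, p j].
Proof.
move=> h; rewrite (ev_not (b := [exists j, ~~ p j])) ?negb_exists; last first.
  by apply: ev_ex => j; apply: ev_not.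
by congr nat_of_bool; apply: eq_forallb => j; rewrite negbK.
Qed.

Lemma ev_muln vs i x : nth 0 vs i = x -> ev vs (timesE i) = x * n.
Proof. by move=> h; rewrite (ev_sum (F := fun=> x)) // sum_nat_const card_ord mulnC. Qed.

Lemma ev_adj vs i j (u v : 'I_n) : nth 0 vs i = u -> nth 0 vs j = v ->
  ev vs (adjE i j) = adj G u v.
Proof.
move=> hu hv; rewrite -mG -[LHS]/(m (ev vs (timesE i) + nth 0 vs j)).
by rewrite (ev_muln hu) hv.
Qed.

Lemma ev_nbr vs i j (u v : 'I_n) : nth 0 vs i = u -> nth 0 vs j = v ->
  ev vs (nbrE i j) = a u v.
Proof.
move=> hu hv.
rewrite -[LHS]/(if ev vs (equalE (Var i) (Var j)) != 0 then 1 else ev vs (adjE i j)).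
rewrite (ev_eq (x := u) (y := v)) // (ev_adj hu hv) /nbr eqb0 negbK.
by rewrite (inj_eq val_inj); case: eqP.
Qed.

Lemma ev_twin vs i j (u v : 'I_n) : nth 0 vs i = u -> nth 0 vs j = v ->
  ev vs (twinE i j) = twin a u v.
Proof.
move=> hu hv; apply: ev_all => w.
by rewrite (ev_eq (ev_nbr (u := u) (v := w) _ _) (ev_nbr (u := v) (v := w) _ _)) //; do 2!case: (a _ _).
Qed.

Lemma ev_class vs i (u : 'I_n) : nth 0 vs i = u -> ev vs (classE i) = #|class a u|.
Proof. by move=> hu; apply: ev_count => j; apply: ev_twin. Qed.

Lemma ev_crank vs i (u : 'I_n) : nth 0 vs i = u -> ev vs (crankE i) = crank a u.
Proof.
move=> hu; apply: (ev_count (p := fun j => (j \in class a u) && (j < u))) => j.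
by rewrite inE; apply: ev_and; [apply: ev_twin | apply: ev_lt].
Qed.

Lemma ev_k2 vs : ev vs k2E = k.*2.
Proof. by rewrite /= g1 addnn. Qed.

Lemma ev_k4 vs : ev vs k4E = 4 * k.
Proof. by rewrite -[LHS]/(ev vs k2E + ev vs k2E) !ev_k2; lia. Qed.

Lemma ev_width vs : ev vs widthE = width k.
Proof. by rewrite -[LHS]/(ev vs k4E + 1) ev_k4 addn1. Qed.

Lemma ev_large vs i (u : 'I_n) : nth 0 vs i = u -> ev vs (largeE i) = (u \in large a k).
Proof. by move=> hu; rewrite inE; apply: ev_lt; [apply: ev_k2 | apply: ev_class]. Qed.

Lemma ev_in_rest vs i (u : 'I_n) : nth 0 vs i = u -> ev vs (in_restE i) = (u \in rest a k).
Proof.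
move=> hu; rewrite inE; apply: ev_all => j.
by apply: ev_imp; [apply: ev_large | apply: ev_not; apply: ev_nbr].
Qed.

Lemma ev_has_rest vs : ev vs has_restE = [exists i, i \in rest a k].
Proof. by apply: ev_ex => j; apply: ev_in_rest. Qed.

Lemma ev_trimmed vs i (u : 'I_n) : nth 0 vs i = u -> ev vs (trimmedE i) = (u \in trimmed a k).
Proof. by move=> hu; rewrite inE; apply: ev_lt; [apply: ev_crank | apply: ev_width]. Qed.

Lemma ev_csize vs i (u : 'I_n) : nth 0 vs i = u -> ev vs (csizeE i) = csize a k u.
Proof. by move=> hu; apply: ev_min; [apply: ev_class | apply: ev_width]. Qed.

Lemma ev_deg vs i (u : 'I_n) : nth 0 vs i = u -> ev vs (degE i) = deg a [set: 'I_n] u.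
Proof.
move=> hu; apply: (ev_count (p := fun j => (j \in [set: 'I_n]) && a u j)) => j.
by rewrite inE; apply: ev_nbr.
Qed.

Lemma ev_deg_trimmed vs i (u : 'I_n) : nth 0 vs i = u ->
  ev vs (deg_trimmedE i) = deg a (trimmed a k) u.
Proof.
move=> hu; apply: (ev_count (p := fun j => (j \in trimmed a k) && a u j)) => j.
by apply: ev_and; [apply: ev_trimmed | apply: ev_nbr].
Qed.

Lemma ev_maxlarge vs e (A : {set 'I_n}) :
  (forall vs' (u : 'I_n), nth 0 vs' 0 = u -> ev vs' e = deg a A u) ->
  ev vs (maxlargeE e) = maxdeg a k A.
Proof.
move=> he; rewrite (ev_count (p := fun j : 'I_n => j < maxdeg a k A)); last first.
  move=> j; rewrite (ev_ex (p := fun u => (u \in large a k) && (j < deg a A u))).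
    congr nat_of_bool; apply/existsP/idP => [[u /andP[uL ju]]|jM].
      exact: leq_trans ju (maxdeg_ge _ uL).
    have [e0|[u uL]] := set_0Vmem (large a k).
      by move: jM; rewrite /maxdeg big_pred0 // => i; rewrite e0 inE.
    have [v vL ev] := maxdeg_attained A uL.
    by exists v; rewrite vL -ev.
  by move=> u; apply: ev_and; [apply: ev_large | apply: ev_lt => //; apply: he].
(* The count ranges over [j < n] only, so it reaches the maximum because degrees are at most [n]. *)
have Mn : maxdeg a k A <= n.
  by apply/bigmax_leqP => i _; rewrite -[X in _ <= X]card_ord max_card.
rewrite -sum1_card (eq_bigl (fun j : 'I_n => j < maxdeg a k A)); last by move=> j; rewrite inE.
by rewrite -(big_ord_widen n (fun=> 1) Mn) sum1_card card_ord.
Qed.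

Lemma ev_shrink vs : ev vs shrinkE = shrink a k.
Proof.
rewrite -[LHS]/(ev vs (maxlargeE (degE 0)) - ev vs (maxlargeE (deg_trimmedE 0))).
have h1 : ev vs (maxlargeE (degE 0)) = maxdeg a k [set: 'I_n].
  by apply: ev_maxlarge => vs' u; apply: ev_deg.
have h2 : ev vs (maxlargeE (deg_trimmedE 0)) = maxdeg a k (trimmed a k).
  by apply: ev_maxlarge => vs' u; apply: ev_deg_trimmed.
by rewrite h1 h2.
Qed.

Lemma ev_isolated vs i (u : 'I_n) : nth 0 vs i = u -> ev vs (isolatedE i) = isolated a u.
Proof.
move=> hu; apply: ev_all => j.
by apply: ev_imp; [apply: ev_nbr | apply: ev_twin].
Qed.

Lemma ev_is_rep vs i (u : 'I_n) : nth 0 vs i = u -> ev vs (is_repE i) = is_rep a u.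
Proof. by move=> hu; apply: ev_eq => //; apply: ev_crank. Qed.

Lemma ev_clique_rank vs i (u : 'I_n) : nth 0 vs i = u ->
  ev vs (clique_rankE i) = clique_rank a k u.
Proof.
move=> hu; apply: (ev_count (p := fun j => (j \in clique_reps a k (csize a k u)) &&
  [forall w, twin a u w ==> (j < w)])) => j.
rewrite inE; apply: ev_and.
  apply: ev_and; first exact: ev_is_rep.
  by apply: ev_and; [apply: ev_isolated | apply: ev_eq; apply: ev_csize].
by apply: ev_all => w; apply: ev_imp; [apply: ev_twin | apply: ev_lt].
Qed.

Lemma ev_kept vs i (u : 'I_n) : nth 0 vs i = u -> ev vs (keptE i) = (u \in kept a k).
Proof.
move=> hu; rewrite inE; apply: ev_and; first exact: ev_trimmed.
apply: ev_imp; first exact: ev_isolated.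
by apply: ev_le; [apply: ev_clique_rank | apply: ev_k2].
Qed.

Lemma ev_mixed vs : ev vs mixedE = #|mixed_reps a|.
Proof.
apply: ev_count => j; apply: ev_and; first exact: ev_is_rep.
by apply: ev_not; apply: ev_isolated.
Qed.

Lemma ev_ite_bool vs c e1 e2 b x1 x2 : ev vs c = b -> ev vs e1 = x1 -> ev vs e2 = x2 ->
  ev vs (Ite c e1 e2) = if b then x1 else x2.
Proof. by move=> /= -> -> ->; case: b. Qed.

Lemma ev_accepted vs : ev vs acceptedE = accepted I.
Proof.
apply: ev_and; first by apply: ev_le; [apply: ev_mixed | apply: ev_k4].
rewrite (ev_ite_bool (ev_has_rest vs) (x1 := shrink a k <= eta) (x2 := [forall i, (i \in large a k) ==>
          [forall j, (j \in large a k) ==>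
             (deg a [set: 'I_n] i <= deg a [set: 'I_n] j + eta)]])).
- by case: ifP.
- by apply: ev_le; first exact: ev_shrink.
apply: ev_all => i; apply: ev_imp; first exact: ev_large.
apply: ev_all => j; apply: ev_imp; first exact: ev_large.
apply: ev_le; first exact: ev_deg.
by rewrite -[LHS]/(ev _ (degE 0) + g 2) g2; congr (_ + _); apply: ev_deg.
Qed.

Lemma ev_kernel_imbalance vs : ev vs kernel_imbalanceE = kernel_imbalance I.
Proof.
rewrite (ev_ite_bool (ev_has_rest vs) (x1 := eta - shrink a k) (x2 := n)) //.
by rewrite -[LHS]/(g 2 - ev vs shrinkE) g2 ev_shrink.
Qed.

Lemma ev_card_kept vs : ev vs card_keptE = #|kept a k|.
Proof.
rewrite (ev_count (p := fun j => j \in kept a k)); last by move=> j; apply: ev_kept.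
by apply: eq_card => j; rewrite inE.
Qed.

Lemma ev_kept_rank vs i (u : 'I_n) : nth 0 vs i = u ->
  ev vs (kept_rankE i) = rank (kept a k) u.
Proof.
move=> hu; apply: (ev_count (p := fun j => (j \in kept a k) && (j < u))) => j.
by apply: ev_and; [apply: ev_kept | apply: ev_lt].
Qed.

Lemma ev_kernel_rel x y : ev [:: y; x] kernel_adjE = kernel_rel I x y.
Proof.
apply: ev_ex => i; apply: ev_ex => j.
apply: ev_and; first exact: ev_kept.
apply: ev_and; first exact: ev_kept.
apply: ev_and; first by apply: ev_eq => //; apply: ev_kept_rank.
apply: ev_and; first by apply: ev_eq => //; apply: ev_kept_rank.
exact: ev_adj.
Qed.

End Evaluation.

(** * The program and its correctness *)

Definition put (c : nat * nat) : cmd :=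
  Seq (Const 6 c.1) (Seq (Const 7 c.2) (Write 6 7)).

Definition puts (cs : seq (nat * nat)) : cmd := foldr (fun c => Seq (put c)) Skip cs.

Definition updates (m : nat -> nat) (cs : seq (nat * nat)) : nat -> nat :=
  foldl (fun m c => upd m c.1 c.2) m cs.

Lemma runs_puts cs s :
  runs (puts cs) s (size cs * 3 + 1) (fun s' => memory s' = updates (memory s) cs).
Proof.
elim: cs s => [|c cs IH] s /=; first exact: runs_exec (exec_skip _) _.
rewrite mulSn -addnA; apply: (@runs_seq _ _ _ _ _ (fun s' => memory s' = upd (memory s) c.1 c.2)).
  exact: runs_exec (exec_seq (exec_const _ _ _) (exec_seq (exec_const _ _ _) (exec_write _ _ _))) _.
by move=> s' <-; apply: IH.
Qed.

(** Zero entries are written as well, since the memory still holds the input matrix. *)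
Definition no_cells : seq (nat * nat) :=
  [:: (0, 0); (1, 1); (2, 0); (3, 1); (4, 0); (5, 0); (6, 0); (7, 0); (8, 0)].

Definition no_program : cmd :=
  Seq (puts no_cells) (Seq (Const 0 3) (Seq (Const 1 0) (Const 2 0))).

Lemma runs_no_program s :
  runs no_program s 31 (fun s' => output_state s' no_instance).
Proof.
(* Nine cells at three steps each and a final [Skip], then three constants. *)
apply: (@runs_seq _ _ _ 28 3) (runs_puts no_cells s) _ => s1 m1.
apply: runs_exec (exec_seq (exec_const _ _ _) (exec_seq (exec_const _ _ _) (exec_const _ _ _))) _.
split=> // i j; rewrite adj_no_instance /= m1.
by case: i => [[|[|[|]]] ?] //; case: j => [[|[|[|]]] ?].
Qed.

Definition stashE := AddE (Sum (Glob 0)) (AddE (timesE 1) (Var 0)).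

(** The product of the row and the new vertex number is an [n]-term sum in which only the indices
    below register 4 contribute. *)
Definition targetE := Ite (andE (ltE (Var 1) (Glob 4)) (ltE (Var 0) (Glob 4)))
  (AddE (Sum (Ite (ltE (Var 0) (Glob 4)) (Var 2) (Cst 0))) (Var 0))
  (AddE (Sum (Glob 0)) (Sum (Glob 0))).

(* The new matrix is first assembled at address n * n, since computing its    *)
(* entries needs the whole input; then it is moved to address 0. Positions    *)
(* outside the new matrix are sent to the dummy address 2 * n * n.            *)
Definition yes_program : cmd :=
  Seq (fill stashE kernel_adjE) (Seq (fill targetE (Rd stashE))
    (Seq (assign 0 (Glob 4)) (assign 2 (Glob 5)))).

(** All results are computed into registers 3 to 5 before the memory and register 0, on which every
    [Sum] depends, are overwritten. *)
Definition program : cmd :=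
  Seq (assign 3 acceptedE) (Seq (assign 4 card_keptE)
    (Seq (assign 5 kernel_imbalanceE) (If 3 yes_program no_program))).

Definition time_program (N : nat) : nat :=
  time acceptedE N + 2 + (time card_keptE N + 2 + (time kernel_imbalanceE N + 2 +
    (time_fill stashE kernel_adjE N + (time_fill targetE (Rd stashE) N + (4 + 4)) + 31 + 1))).

Lemma poly_bounded_program : poly_bounded time_program.
Proof.
rewrite /time_program.
by repeat first [exact: poly_bounded_time | exact: poly_bounded_fill
  | exact: poly_bounded_const | apply: poly_boundedD].
Qed.

Lemma row_major_inj N x y x' y' : y < N -> y' < N ->
  x * N + y = x' * N + y' -> x = x' /\ y = y'.
Proof.
move=> yN y'N e; have N0 : 0 < N by apply: leq_trans yN.
have := congr1 (divn^~ N) e; have := congr1 (modn^~ N) e.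
by rewrite /= !modnMDl !divnMDl // !modn_small // !divn_small // !addn0.
Qed.

Lemma row_major_lt N x y : x < N -> y < N -> x * N + y < N * N.
Proof. by move=> xN yN; nia. Qed.

Lemma input_memory I (i j : 'I_(nverts I)) :
  memory (input_state I) (i * nverts I + j) = adj (igraph I) i j.
Proof.
congr nat_of_bool; apply/existsP/idP => [[i' /existsP[j' /andP[/eqP e]]]|h].
  have [ei ej] := row_major_inj (ltn_ord j) (ltn_ord j') e.
  by rewrite (val_inj ei) (val_inj ej).
by exists i; apply/existsP; exists j; rewrite eqxx.
Qed.

Lemma runs_program I :
  runs program (input_state I) (time_program (nverts I))
    (fun s => output_state s (kernel I)).
Proof.
set n := nverts I; set m := memory (input_state I).
pose g := regs (input_state I).
have mG (i j : 'I_n) : m (i * n + j) = adj (igraph I) i j by apply: input_memory.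
have ag : agree g m (input_state I) by split.
apply: (runs_seq (runs_assign (r := 3) acceptedE isT ag)) => s1.
rewrite (@ev_accepted I) //; set g1 := upd _ _ _ => ag1.
apply: (runs_seq (runs_assign (r := 4) card_keptE isT ag1)) => s2.
rewrite (@ev_card_kept I) //; set g2 := upd _ _ _ => ag2.
apply: (runs_seq (runs_assign (r := 5) kernel_imbalanceE isT ag2)) => s3.
rewrite (@ev_kernel_imbalance I) //; set g3 := upd _ _ _ => ag3.
have acc3 : regs s3 3 = accepted I by rewrite ag3.1.
apply: runs_if; rewrite acc3 /kernel; case: (accepted I) => // _; last first.
  exact: runs_no_program.
 set n' := #|kept (nbr (igraph I)) (budget I)|.
have n'n : n' <= n by rewrite /n' -[X in _ <= X]card_ord max_card.
have nn : n' * n' <= n * n by apply: leq_mul.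
have g30 : g3 0 = n by [].
have sumG vs m' : eval g3 m' vs (Sum (Glob 0)) = n * n.
  by rewrite (@ev_sum I g3 m' g30 _ _ (fun=> n)) // sum_nat_const card_ord.
have evS m' x y : eval g3 m' [:: y; x] stashE = n * n + (x * n + y).
  rewrite -[LHS]/(eval g3 m' [:: y; x] (Sum (Glob 0)) + (eval g3 m' [:: y; x] (timesE 1) + y)).
  by rewrite sumG (@ev_muln I g3 m' g30 _ _ x).
(* The first pass protects the input matrix, the cells below [n * n]. *)
apply: (runs_seq (@runs_fill g3 m (fun p => p < n * n) (fun x y => n * n + (x * n + y))
    (fun x y => kernel_rel I x y) stashE kernel_adjE _ _ _ s3 ag3)).
- by move=> m' x y _ _ _; apply: evS.
- move=> m' x y m'P _ _; apply: ev_kernel_rel => // i j.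
  by rewrite m'P ?mG // row_major_lt.
- by move=> x y _ _; rewrite -leqNgt leq_addr.
move=> s4 [m4 ag4 [_ st4]].
pose A x y := if (x < n') && (y < n') then x * n' + y else n * n + n * n.
(* The second pass protects the stashed copy and may overwrite the input. *)
apply: (runs_seq (@runs_fill g3 m4 (fun p => (n * n <= p) && (p < n * n + n * n)) A
    (fun x y => m4 (n * n + (x * n + y))) targetE (Rd stashE) _ _ _ s4 ag4)).
- move=> m' x y _ xn yn; rewrite /targetE /A.
  apply: ev_ite_bool.
  + by apply: ev_and; apply: ev_lt.
  + set e0 := Sum _; have e : eval g3 m' [:: y; x] e0 = x * n'.
      rewrite (@ev_sum I g3 m' g30 _ _ (fun w => if w < n' then x else 0)); last first.
        by move=> j; apply: ev_ite_bool => //; apply: ev_lt.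
      rewrite -big_mkcond /= -(big_ord_widen n (fun=> x) n'n) sum_nat_const card_ord.
      by rewrite mulnC.
    by rewrite -[LHS]/(eval g3 m' [:: y; x] e0 + y) e.
  + set e0 := Sum _; rewrite -[LHS]/(eval g3 m' [:: y; x] e0 + eval g3 m' [:: y; x] e0).
    by rewrite sumG.
- move=> m' x y m'P xn yn; rewrite -[LHS]/(m' (eval g3 m' [:: y; x] stashE)) evS m'P //.
  by rewrite leq_addr ltn_add2l row_major_lt.
- move=> x y _ _; rewrite /A; case: ifP => [/andP[xn yn]|_]; last by rewrite ltnn andbF.
  by rewrite leqNgt (leq_trans (row_major_lt xn yn)).
move=> s5 [m5 ag5 [_ st5]].
apply: (runs_seq (runs_assign (r := 0) (Glob 4) isT ag5)) => s6 ag6.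
apply: runs_weaken (runs_assign (r := 2) (Glob 5) isT ag6) => // s7 [r7 m7].
have out (i j : 'I_n') : m5 (i * n' + j) = kernel_rel I i j.
  have il : i < n := leq_trans (ltn_ord i) n'n; have jl : j < n := leq_trans (ltn_ord j) n'n.
  have ij := row_major_lt (ltn_ord i) (ltn_ord j).
  have Aij : A i j = i * n' + j by rewrite /A !ltn_ord.
  have := st5 i j il jl isT; rewrite Aij => ->.
    apply: st4 => // x y xn yn /addnI; exact: row_major_inj.
  (* The dummy address lies beyond the output, as [n' * n' <= n * n]. *)
  move=> x y xn yn; rewrite /A; case: ifP => [/andP[xn' yn']|_ e]; first exact: row_major_inj.
  by move: ij; rewrite -e ltnNge (leq_trans nn) // leq_addr.
split; rewrite ?r7 //= => i j.
by rewrite m7 out adj_kernel.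
Qed.

(** * Output size and polynomial running time *)

Lemma leq_bitlen x y : x <= y -> bitlen x <= bitlen y.
Proof. by move=> xy; rewrite ltnS; apply: leq_trunc_log. Qed.

Lemma bitlen_max x y : bitlen (maxn x y) <= bitlen x + bitlen y.
Proof.
by rewrite /maxn; case: ifP => _; rewrite ?leq_addr ?leq_addl.
Qed.

(** The 11 is the matrix of [no_instance], 9 cells, plus the two bits of its vertex number 3. *)
Lemma isize_kernel I : isize (kernel I) <= 2 * isize I + 11.
Proof.
have h1 := nverts_kernel_le I.
have h2 := leq_trans (leq_bitlen h1) (bitlen_max _ _).
have h3 := leq_bitlen (budget_kernel I).
have h4 := leq_trans (leq_bitlen (imbalance_kernel I)) (bitlen_max _ _).
have h5 : bitlen 3 = 2 by [].
have h6 : nverts (kernel I) * nverts (kernel I) <= nverts I * nverts I + 9.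
  by apply: leq_trans (leq_mul h1 h1) _; nia.
rewrite /isize; lia.
Qed.

Lemma polytime_kernel : polytime_computable kernel.
Proof.
have [c [d hc]] := poly_bounded_program.
(* The exponent [d.+1] is positive, so it also covers the linear bound on the output size, and the
   11 covers its additive constant. *)
exists program, (c + 11), d.+1 => I.
have [t [s [x tl out]]] := runs_program I.
have nI : (nverts I).+1 <= isize I by rewrite /isize /bitlen; nia.
have I0 : 0 < isize I by apply: leq_trans nI.
have le1 : isize I ^ d <= isize I ^ d.+1 by rewrite leq_pexp2l.
have le2 : isize I <= isize I ^ d.+1 by rewrite -[X in X <= _]expn1 leq_pexp2l.
exists t, s; split=> //.
  apply: leq_trans tl _; apply: leq_trans (hc _) _.
  apply: leq_trans (_ : c * isize I ^ d <= _).
    by rewrite leq_mul2l; apply/orP; right; case: (d) => // d'; rewrite leq_exp2r.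
  by nia.
by apply: leq_trans (isize_kernel I) _; nia.
Qed.

Theorem mainTheorem3 :
  exists f : instance -> instance,
    polytime_computable f /\
    exists C : nat, forall I : instance,
      [/\ yes_instance (f I) <-> yes_instance I,
          nverts (f I) <= C * (budget I ^ 3 + 1) &
          budget (f I) <= budget I].
Proof.
exists kernel; split; first exact: polytime_kernel.
exists 200 => I; split; [exact: kernel_correct | exact: nverts_kernel | exact: budget_kernel].
Qed.
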